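(* Let $\omega$ be an admissible weight on $\mathbb{N}$, let $\mathcal{A}$ be a commutative unital complex Banach algebra, and let $f\in\mathcal{D}(\mathbb{N},\omega,\mathcal{A})$. Then $f$ is invertible in $\mathcal{D}(\mathbb{N},\omega,\mathcal{A})$ if and only if $\overline{\{f(s):s\in\mathcal H\}}\subset G(\mathcal{A})$ (closure in $\mathcal A$).
   Context: $\mathcal{H}=\{s\in\mathbb C:\operatorname{Re}s\geq 0\}$; $G(\mathcal A)$ is the set of invertible elements of $\mathcal A$. A weight on $\mathbb N$ (as a multiplicative semigroup, equivalently on $\log\mathbb N$) is a map $\omega:\mathbb N\to[1,\infty)$ with $\omega(1)=1$ and $\omega(mn)\le\omega(m)\omega(n)$ for all $m,n$; it is admissible if $\lim_{k\to\infty}\omega(n^k)^{1/k}=1$ for all $n\in\mathbb N$. $\mathcal D(\mathbb N,\omega,\mathcal A)$ is the set of functions $f:\mathcal H\to\mathcal A$ of the form $f(s)=\sum_{n\in\mathbb N}f_n n^{-s}$ with $f_n\in\mathcal A$ and $\|f\|_\omega=\sum_n\|f_n\|\omega(n)<\infty$; it is a unital Banach algebra under pointwise multiplication and $\|\cdot\|_\omega$. *)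

(* Defs.v *)
From HB Require Import structures.
From mathcomp Require Import all_boot all_order all_algebra.
From mathcomp Require Import all_classical all_reals all_analysis.
From mathcomp Require Import complex.
Set Implicit Arguments. Unset Strict Implicit. Unset Printing Implicit Defensive.
Import Order.TTheory GRing.Theory Num.Theory.
Import numFieldNormedType.Exports.
Local Open Scope classical_set_scope.
Local Open Scope ring_scope.

(* A commutative unital complex Banach algebra structure on a complete normed
   space A over the scalar field K: an associative, commutative, bilinear
   multiplication with unit, submultiplicative norm and ||1|| = 1.
   (MathComp-Analysis has no normed-algebra hierarchy, and HB cannot join the
   ring and normed hierarchies here, so the multiplication is packaged as a
   record over the complete normed module.) *)
Record comBanachAlg (K : numFieldType) (A : completeNormedModType K) := ComBanachAlg {
  bmul : A -> A -> A ;
  bone : A ;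
  bmulA : forall x y z, bmul x (bmul y z) = bmul (bmul x y) z ;
  bmulC : forall x y, bmul x y = bmul y x ;
  bmul1 : forall x, bmul bone x = x ;
  bmulDl : forall x y z, bmul (x + y) z = bmul x z + bmul y z ;
  bmulZl : forall (k : K) x y, bmul (k *: x) y = k *: bmul x y ;
  bnormM : forall x y, `|bmul x y| <= `|x| * `|y| ;
  bnorm1 : `|bone| = 1
}.

Definition invertibles (K : numFieldType) (A : completeNormedModType K)
  (B : comBanachAlg A) : set A :=
  [set x | exists y, bmul B x y = bone B].

Section Dirichlet.
Variable R : realType.
Local Notation C := R[i].
Local Open Scope complex_scope.

Definition halfplane : set C := [set s | 0 <= complex.Re s].

(* n^{-s} = exp(-s log n) for n >= 1 and s complex *)
Definition npow_neg (n : nat) (s : C) : C :=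
  let t := ln (n%:R : R) in
  (expR (- complex.Re s * t))%:C *
  ((cos (complex.Im s * t))%:C - 'i * (sin (complex.Im s * t))%:C).

(* weights on the multiplicative semigroup N = {1,2,...} (values at 0 are
   irrelevant) *)
Definition weight (w : nat -> R) : Prop :=
  [/\ forall n, (0 < n)%N -> 1 <= w n,
      w 1%N = 1 &
      forall m n, (0 < m)%N -> (0 < n)%N -> w (m * n)%N <= w m * w n].

Definition admissible (w : nat -> R) : Prop :=
  forall n, (0 < n)%N ->
    (fun k : nat => w (n ^ k)%N `^ (k%:R^-1)) @ \oo --> (1 : R).

Variable A : completeNormedModType C.

Definition wsummable (w : nat -> R) (a : nat -> A) : Prop :=
  (\sum_(1 <= n <oo) ((complex.Re `|a n| * w n)%:E) < +oo)%E.

Definition dirichlet (a : nat -> A) (s : C) : A :=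
  \big[+%R/0]_(1 <= n <oo) (npow_neg n s *: a n).

Definition inD (w : nat -> R) (f : C -> A) : Prop :=
  exists a : nat -> A, wsummable w a /\ forall s, halfplane s -> f s = dirichlet a s.

End Dirichlet.

(* Main.v *)
Require Import Defs.
From HB Require Import structures.
From mathcomp Require Import all_boot all_order all_algebra.
From mathcomp Require Import all_classical all_reals all_analysis.
From mathcomp Require Import complex.
From mathcomp Require Import zify ring lra.
Set Implicit Arguments. Unset Strict Implicit. Unset Printing Implicit Defensive.
Import Order.TTheory GRing.Theory Num.Theory.
Import numFieldNormedType.Exports.
Local Open Scope classical_set_scope.
Local Open Scope ring_scope.

(** Only the reverse implication needs an idea, and it can be had without Gelfand theory. For
    [v] in the algebra, the spectral radius of [v] is at most [sup |v(s)|] over the half-plane: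
    cutting [v] to a Dirichlet polynomial [p], the coefficients of [p ^+ i] are bounded by
    [sup |p| ^+ i] (a discrete mean value on the imaginary axis), and [p ^+ i] is supported on
    the products [\prod_l l ^ al l] with all [al l <= i], whose weights grow subexponentially by
    admissibility. So if [u] is invertible and its pointwise inverses are bounded by [M], every
    [u'] with [|u - u'| < 1 / M] is invertible. The range of [f] is totally bounded, whence one
    [M] serves for all the translates [f (s + sigma)]; finitely many steps lead from the constant
    [f (+oo)] to [f]. *)

(** * Dirichlet convolution *)

(** The number of steps is finite because the admissible step length depends only on the supremum
    bound [M] of the pointwise inverses; the weighted norm of the inverse may grow at every step and
    is never estimated. Translation preserves [M]: since [s + sigma] stays in the half-plane, each
    translate takes only values already taken by [f]. That the hypothesis concerns the closure and
    not only the range enters twice. It bounds the inverses, because a limit of values whose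
    inverses blow up cannot be invertible; and it makes the coefficient of the integer 1, the limit
    of [f] at [+oo], invertible, which provides the starting point. The forward implication is the
    converse observation: values with bounded inverses have invertible limits. *)

Lemma sum_ord_pick (V : nmodType) (N p : nat) (G : nat -> V) :
  \sum_(m < N) (if (m : nat) == p then G m else 0) = if (p < N)%N then G p else 0.
Proof.
case: ifPn => hp.
  rewrite (bigD1 (Ordinal hp)) //= eqxx big1 ?addr0// => i /negbTE hi.
  by rewrite ifF//; apply: contraFF hi => /eqP e; apply/eqP/val_inj.
rewrite big1// => i _; rewrite ifF//; apply/negbTE; apply: contraNneq hp => <-.
exact: ltn_ord.
Qed.

Lemma sum_ord_widen (V : nmodType) (n N : nat) (G : nat -> V) : (n <= N)%N ->
  (forall i, (n <= i)%N -> G i = 0) -> \sum_(i < N) G i = \sum_(i < n) G i.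
Proof.
move=> nN h; rewrite (big_ord_widen N G nN) [RHS]big_mkcond /=.
by apply: eq_bigr => i _; case: ltnP => // /h.
Qed.

(* Index [i] of a coefficient sequence stands for the integer [i.+1]. *)
Definition dseries (V : Type) := nat -> V.

Section DseriesRing.
Variable V : comNzRingType.
Implicit Types a b c : nat -> V.

Definition conv a b : nat -> V := fun n =>
  \sum_(i < n.+1) \sum_(j < n.+1) (if (i.+1 * j.+1 == n.+1)%N then a i * b j else 0).

(** A factor of [n.+1] is at most [n.+1], so a larger box adds only zero terms. A box common to all
    [n] is what later allows sums over [n] and over the factors to be exchanged. *)
Lemma convE N a b n : (n < N)%N ->
  conv a b n =
  \sum_(i < N) \sum_(j < N) (if (i.+1 * j.+1 == n.+1)%N then a i * b j else 0).
Proof.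
move=> nN; rewrite /conv.
pose F M i := \sum_(j < M) (if (i.+1 * j.+1 == n.+1)%N then a i * b j else 0).
rewrite -[RHS]/(\sum_(i < N) F N i) (sum_ord_widen (n := n.+1) (G := F N) nN); last first.
  move=> i ni; rewrite /F big1// => j _; rewrite ifF//; apply/eqP; nia.
apply: eq_bigr => i _; apply/esym.
apply: (sum_ord_widen (G := fun j => if (i.+1 * j.+1 == n.+1)%N then a i * b j else 0)) => // j nj.
by rewrite ifF//; apply/eqP; nia.
Qed.

Lemma convC a b : conv a b = conv b a.
Proof.
apply/funext => n; rewrite /conv exchange_big /=.
by apply: eq_bigr => i _; apply: eq_bigr => j _; rewrite mulnC mulrC.
Qed.

(** This form is symmetric in the three factors, so associativity reduces to commutativity and
    exchanges of sums. *)
Lemma conv3E a b c n : conv a (conv b c) n =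
  \sum_(i < n.+1) \sum_(j < n.+1) \sum_(k < n.+1)
    (if (i.+1 * j.+1 * k.+1 == n.+1)%N then a i * b j * c k else 0).
Proof.
rewrite /conv -/(conv b c); apply: eq_bigr => i _.
(* The divisibility condition is rewritten as an indicator in [m], so that after exchanging the sums
   [sum_ord_pick] removes the intermediate index. *)
have -> : \sum_(m < n.+1) (if (i.+1 * m.+1 == n.+1)%N then a i * conv b c m else 0) =
  \sum_(m < n.+1) \sum_(j < n.+1) \sum_(k < n.+1)
    (if (m : nat) == (j.+1 * k.+1).-1 then
       if (i.+1 * j.+1 * k.+1 == n.+1)%N then a i * b j * c k else 0 else 0).
  apply: eq_bigr => m _; rewrite (@convE n.+1)//.
  case: ifPn => h.
    rewrite mulr_sumr; apply: eq_bigr => j _; rewrite mulr_sumr; apply: eq_bigr => k _.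
    rewrite (fun_if ( *%R (a i))) mulr0 mulrA.
    have -> : ((m : nat) == (j.+1 * k.+1).-1) = (j.+1 * k.+1 == m.+1)%N by lia.
    by case: ifPn => // /eqP h'; rewrite ifT// -mulnA h'.
  rewrite big1// => j _; rewrite big1// => k _; case: ifPn => // /eqP h'.
  rewrite ifF//; apply: contraNF h; rewrite -mulnA.
  by rewrite (_ : j.+1 * k.+1 = m.+1)%N // h' prednK.
rewrite exchange_big; apply: eq_bigr => j _ /=; rewrite exchange_big; apply: eq_bigr => k _ /=.
rewrite (sum_ord_pick _ _ (fun=> if (i.+1 * j.+1 * k.+1 == n.+1)%N then a i * b j * c k else 0)).
case: ifPn => // h; rewrite ifF//; apply: contraNF h => /eqP h.
nia.
Qed.

Lemma convA a b c : conv a (conv b c) = conv (conv a b) c.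
Proof.
apply/funext => n; rewrite (convC (conv a b)) !conv3E.
rewrite [RHS]exchange_big; apply: eq_bigr => i _ /=.
rewrite exchange_big; apply: eq_bigr => j _ /=; apply: eq_bigr => k _.
rewrite (_ : i.+1 * k.+1 * j.+1 = j.+1 * i.+1 * k.+1)%N; last by lia.
by rewrite mulrC mulrA.
Qed.

Definition constd (x : V) : dseries V := fun n => if n == 0%N then x else 0.

Lemma conv_constd x b : conv (constd x) b = fun n => x * b n.
Proof.
apply/funext => n; rewrite /conv (eq_bigr (fun i : 'I_n.+1 => if (i : nat) == 0%N then x * b n else 0)).
  by rewrite (sum_ord_pick _ _ (fun=> x * b n)).
move=> i _; rewrite /constd; case: ifPn => [/eqP ->|_]; last first.
  by rewrite big1// => j _; rewrite mul0r if_same.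
rewrite (eq_bigr (fun j : 'I_n.+1 => if (j : nat) == n then x * b j else 0)).
  by rewrite (sum_ord_pick _ _ (fun j => x * b j)) ltnSn.
by move=> j _; rewrite mul1n eqSS.
Qed.

Definition cone : nat -> V := constd 1.

Lemma conv1 b : conv cone b = b.
Proof. by rewrite /cone conv_constd; apply/funext => n; rewrite mul1r. Qed.

Lemma convDl a b c : conv (fun n => a n + b n) c = fun n => conv a c n + conv b c n.
Proof.
apply/funext => n; rewrite -big_split; apply: eq_bigr => i _ /=.
rewrite -big_split; apply: eq_bigr => j _ /=.
by case: ifP => _; rewrite ?addr0// mulrDl.
Qed.

HB.instance Definition _ := GRing.Zmodule.on (dseries V).

Fact cone_neq0 : (cone : dseries V) != 0.
Proof. by apply/eqP => /(congr1 (@^~ 0%N)) /eqP; rewrite /cone /= oner_eq0. Qed.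

HB.instance Definition _ := @GRing.Zmodule_isComNzRing.Build (dseries V) cone conv
  convA convC conv1 convDl cone_neq0.

Lemma dseriesME (a b : dseries V) n : (a * b) n = conv a b n. Proof. by []. Qed.
Lemma dseries1E n : (1 : dseries V) n = if n == 0%N then 1 else 0. Proof. by []. Qed.
Lemma dseriesDE (a b : dseries V) n : (a + b) n = a n + b n. Proof. by []. Qed.
Lemma dseriesNE (a : dseries V) n : (- a) n = - a n. Proof. by []. Qed.
Lemma dseriesBE (a b : dseries V) n : (a - b) n = a n - b n. Proof. by []. Qed.
Lemma dseries0E n : (0 : dseries V) n = 0. Proof. by []. Qed.

End DseriesRing.

(** * The coefficient algebra *)

(* [A] is only a normed module; this alias of it carries the algebra structure given by [B]. *)
Definition alg_of (R : realType) (A : completeNormedModType R[i]) (B : comBanachAlg A) : Type := A.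

Section AlgebraOf.
Variables (R : realType) (A : completeNormedModType R[i]) (B : comBanachAlg A).
HB.instance Definition _ := GRing.Zmodule.on (alg_of B).
Local Notation V := (alg_of B).

Fact bone_neq0 : (bone B : V) != 0.
Proof. by apply/eqP => h; have := bnorm1 B; rewrite h normr0 => /esym/eqP; rewrite oner_eq0. Qed.

HB.instance Definition _ := @GRing.Zmodule_isComNzRing.Build (alg_of B) (bone B) (bmul B)
  (@bmulA _ _ B) (@bmulC _ _ B) (@bmul1 _ _ B) (@bmulDl _ _ B) bone_neq0.
HB.instance Definition _ := @GRing.Zmodule_isLmodule.Build R[i] (alg_of B)
  (fun k x => k *: (x : A)) (@scalerA _ A) (@scale1r _ A) (@scalerDr _ A) (fun x a b => scalerDl x a b).

Fact alg_of_scalerAl (k : R[i]) (x y : V) : k *: (x * y) = (k *: x) * y.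
Proof. exact/esym/bmulZl. Qed.

HB.instance Definition _ := @GRing.Lmodule_isLalgebra.Build R[i] (alg_of B) alg_of_scalerAl.
HB.instance Definition _ := @GRing.Lalgebra_isComAlgebra.Build R[i] (alg_of B).

(** Over [R[i]] the norm is itself a complex number; being nonnegative it equals its real part, and
    passing to that part gives access to suprema and linear arithmetic in [R]. *)
Definition nrm (x : V) : R := complex.Re `|x : A|.

Lemma norm_nrm (x : V) : `|x : A| = (nrm x)%:C%C.
Proof. by rewrite /nrm RRe_real// ger0_real. Qed.

Lemma nrm_ge0 x : 0 <= nrm x.
Proof. rewrite -lecR -norm_nrm; exact: normr_ge0. Qed.

Lemma nrm_eq0 x : nrm x = 0 -> x = 0.
Proof. by move=> h; apply/(@normr0_eq0 _ A); rewrite norm_nrm h. Qed.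

Lemma nrm0 : nrm 0 = 0. Proof. by rewrite /nrm normr0. Qed.

Lemma nrm1 : nrm 1 = 1. Proof. by rewrite /nrm bnorm1. Qed.

Lemma nrmN x : nrm (- x) = nrm x. Proof. by rewrite /nrm normrN. Qed.

Lemma nrmBC x y : nrm (x - y) = nrm (y - x). Proof. by rewrite -nrmN opprB. Qed.

Lemma nrmD x y : nrm (x + y) <= nrm x + nrm y.
Proof. by rewrite -lecR rmorphD/= -!norm_nrm ler_normD. Qed.

Lemma nrmB x y : nrm (x - y) <= nrm x + nrm y.
Proof. by rewrite -(nrmN y) nrmD. Qed.

Lemma nrm_dist z x y : nrm (x - y) <= nrm (x - z) + nrm (z - y).
Proof. by rewrite -[x in leLHS](subrK z) -addrA nrmD. Qed.

Lemma nrmM x y : nrm (x * y) <= nrm x * nrm y.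
Proof. by rewrite -lecR rmorphM/= -!norm_nrm bnormM. Qed.

Lemma nrmZ (k : R[i]) x : nrm (k *: x) = complex.Re `|k| * nrm x.
Proof. by rewrite /nrm normrZ [X in _ * X]norm_nrm -[`|k| in LHS]RRe_real ?ger0_real// -rmorphM. Qed.

Lemma nrm_sum I (r : seq I) (P : pred I) (F : I -> V) :
  nrm (\sum_(i <- r | P i) F i) <= \sum_(i <- r | P i) nrm (F i).
Proof.
elim/big_rec2: _ => [|i x y _ h]; first by rewrite nrm0.
exact: le_trans (nrmD _ _) (lerD (lexx _) h).
Qed.

Lemma nrm_cvg (x : nat -> V) (y : V) :
  (forall eps, 0 < eps -> exists N, forall n, (N <= n)%N -> nrm (y - x n) <= eps) ->
  (x : nat -> A) @ \oo --> (y : A).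
Proof.
move=> h; apply/cvgrPdist_le => e e0.
have e0' : 0 < complex.Re e by move: e0; rewrite ltcE => /andP[].
have [N hN] := h _ e0'; exists N => // n /= Nn.
rewrite (_ : e = (complex.Re e)%:C%C); last by rewrite RRe_real// gtr0_real.
by rewrite (norm_nrm (y - x n)) lecR hN.
Qed.

Lemma cvg_nrm (x : nat -> V) (y : V) : (x : nat -> A) @ \oo --> (y : A) ->
  forall eps, 0 < eps -> exists N, forall n, (N <= n)%N -> nrm (y - x n) <= eps.
Proof.
move=> /cvgrPdist_le h e e0.
have e0' : 0 < e%:C%C by rewrite ltcR.
have [N _ hN] := h _ e0'; exists N => n Nn.
by have := hN n Nn; rewrite /= (norm_nrm (y - x n)) lecR.
Qed.

(** The Cauchy modulus [e] passes to the limit, so that later constructions obtain a rate of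
    convergence with it. *)
Lemma nrm_complete (x : nat -> V) (e : nat -> R) :
  (forall k l, (k <= l)%N -> nrm (x l - x k) <= e k) ->
  (forall eps, 0 < eps -> exists k, e k <= eps) ->
  exists y, forall k, nrm (y - x k) <= e k.
Proof.
move=> hx he.
have : cvg ((x : nat -> A) @ \oo).
  apply: cauchy_cvg; apply: cauchy_exP => eps e0.
  have e0' : 0 < complex.Re eps by move: e0; rewrite ltcE => /andP[].
  have [k hk] := he _ (divr_gt0 e0' (ltr0n R 2)).
  exists (x k); exists k => // l /= kl.
  rewrite -ball_normE /=.
  rewrite (_ : eps = (complex.Re eps)%:C%C); last by rewrite RRe_real// gtr0_real.
  rewrite (norm_nrm (x k - x l)) ltcR nrmBC.
  apply: (le_lt_trans (hx _ _ kl)); apply: (le_lt_trans hk); lra.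
move=> /cvg_nrm h; exists (lim ((x : nat -> A) @ \oo)) => k.
apply/ler_addgt0Pr => eps /h[N hN].
apply: (le_trans (nrm_dist (x (maxn N k)) _ _)).
rewrite addrC lerD ?hN ?leq_maxl//; exact/hx/leq_maxr.
Qed.

End AlgebraOf.

(** * Weighted summability *)

Lemma geometric_small (R : realType) (C t : R) : 0 <= C -> 0 <= t -> t < 1 ->
  forall eps, 0 < eps -> exists k, forall l, (k <= l)%N -> C * t ^+ l <= eps.
Proof.
move=> C0 t0 t1 eps e0.
have : geometric C t @ \oo --> (0 : R) by apply: cvg_geometric; rewrite ger0_norm.
move=> /cvgrPdist_le/(_ _ e0)[k _ hk]; exists k => l kl.
by have := hk l kl; rewrite /= sub0r normrN ger0_norm// mulr_ge0// exprn_ge0.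
Qed.

Lemma sum_geometric_le (R : realType) (t : R) n : 0 <= t -> t < 1 ->
  \sum_(i < n) t ^+ i <= (1 - t)^-1.
Proof.
move=> t0 t1; rewrite -[leRHS]mul1r ler_pdivlMr ?subr_gt0//.
have := subrX1 t n; rewrite -[t - 1]opprB mulNr mulrC => /(congr1 -%R); rewrite opprB opprK => <-.
by rewrite gerBl exprn_ge0.
Qed.

Section WeightedBound.
Variables (R : realType) (A : completeNormedModType R[i]) (B : comBanachAlg A).
Local Notation V := (alg_of B).
Local Notation S := (dseries V).
Implicit Types (a b : S) (K : R).

(** This is the bound of the weighted norm by [K], phrased through partial sums so that no infinite
    series has to be manipulated. *)
Definition wbd (w : nat -> R) (a : S) (K : R) : Prop :=
  forall N, \sum_(i < N) nrm (a i) * w i.+1 <= K.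

Definition trunc (L : nat) (a : S) : S := fun i => if (i < L)%N then a i else 0.

(** For completely multiplicative [z] this respects products. With [z n] equal to [npow_neg n s] it
    yields both the values of a series (by summation) and its translates. *)
Definition twist (z : nat -> R[i]) (a : S) : S := fun i => z i.+1 *: a i.

Definition cmult (z : nat -> R[i]) : Prop := z 1%N = 1 /\
  forall m n, (0 < m)%N -> (0 < n)%N -> z (m * n)%N = z m * z n.

Section Weight.
Variable w : nat -> R.
Hypothesis hw : weight w.

Lemma weight_ge1 n : 1 <= w n.+1. Proof. by have [h _ _] := hw; exact: h. Qed.
Lemma weight_ge0 n : 0 <= w n.+1. Proof. exact: le_trans ler01 (weight_ge1 n). Qed.
Hint Resolve weight_ge0 : core.

Lemma wbd_ge0 a K : wbd w a K -> 0 <= K.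
Proof. by move=> /(_ 0%N); rewrite big_ord0. Qed.

Lemma wbd_le a K (L : R) : K <= L -> wbd w a K -> wbd w a L.
Proof. by move=> KL h N; exact: le_trans (h N) KL. Qed.

Lemma wbd_dom a b K : (forall i, nrm (a i) <= nrm (b i)) -> wbd w b K -> wbd w a K.
Proof.
by move=> h hb N; apply: le_trans (hb N); apply: ler_sum => i _; rewrite ler_wpM2r.
Qed.

Lemma wbd0 : wbd w 0 0.
Proof. by move=> N; rewrite big1// => i _; rewrite dseries0E nrm0 mul0r. Qed.

Lemma wbdD a b K L : wbd w a K -> wbd w b L -> wbd w (a + b) (K + L).
Proof.
move=> ha hb N; apply: le_trans (lerD (ha N) (hb N)); rewrite -big_split /=.
by apply: ler_sum => i _; rewrite -mulrDl ler_wpM2r// dseriesDE nrmD.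
Qed.

Lemma wbdN a K : wbd w a K -> wbd w (- a) K.
Proof. by apply: wbd_dom => i; rewrite dseriesNE nrmN. Qed.

Lemma wbdB a b K L : wbd w a K -> wbd w b L -> wbd w (a - b) (K + L).
Proof. by move=> ha /wbdN; exact: wbdD. Qed.

Lemma wbd_sum I (r : seq I) (P : pred I) (F : I -> S) (K : I -> R) :
  (forall i, P i -> wbd w (F i) (K i)) ->
  wbd w (\sum_(i <- r | P i) F i) (\sum_(i <- r | P i) K i).
Proof. by move=> h; elim/big_ind2: _ => //; [exact: wbd0 | move=> *; exact: wbdD]. Qed.

Lemma wbdMn a K n : wbd w a K -> wbd w (a *+ n) (K *+ n).
Proof.
by move=> h; rewrite -[n]card_ord -!sumr_const; apply: wbd_sum.
Qed.

Lemma wbd_coef a K n : wbd w a K -> nrm (a n) <= K.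
Proof.
move=> h; apply: le_trans (h n.+1); rewrite big_ord_recr /=.
apply: (@le_trans _ _ (nrm (a n) * w n.+1)).
  by rewrite ler_peMr// ?weight_ge1// nrm_ge0.
by rewrite lerDr sumr_ge0// => i _; rewrite mulr_ge0// nrm_ge0.
Qed.

Lemma wbd_unweight a K : wbd w a K -> wbd (fun=> 1) a K.
Proof.
move=> h N; apply: le_trans (h N); apply: ler_sum => i _.
by rewrite ler_wpM2l ?weight_ge1 ?nrm_ge0.
Qed.

Lemma wbd_const x : wbd w (constd x) (nrm x).
Proof.
move=> N; rewrite (eq_bigr (fun i : 'I_N => if (i : nat) == 0%N then nrm x else 0)).
  by rewrite (sum_ord_pick _ _ (fun=> nrm x)); case: ifP => // _; exact: nrm_ge0.
move=> i _; rewrite /constd; case: ifPn => [/eqP ->|_]; last by rewrite nrm0 mul0r.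
by have [_ -> _] := hw; rewrite mulr1.
Qed.

Lemma wbd1 : wbd w 1 1.
Proof. by have := wbd_const 1; rewrite nrm1. Qed.

Lemma wbdM a b K L : wbd w a K -> wbd w b L -> wbd w (a * b) (K * L).
Proof.
move=> ha hb N.
pose X i j := (nrm (a i) * w i.+1) * (nrm (b j) * w j.+1).
have X0 i j : 0 <= X i j by rewrite !mulr_ge0 ?nrm_ge0.
apply: (@le_trans _ _ (\sum_(i < N) \sum_(j < N) X i j)); last first.
  rewrite (eq_bigr (fun i : 'I_N => nrm (a i) * w i.+1 * \sum_(j < N) nrm (b j) * w j.+1)); last first.
    by move=> i _; rewrite mulr_sumr.
  rewrite -mulr_suml; apply: ler_pM (ha N) (hb N);
  by rewrite sumr_ge0// => i _; rewrite mulr_ge0 ?nrm_ge0.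
apply: (@le_trans _ _ (\sum_(n < N) \sum_(i < N) \sum_(j < N)
   (if (n : nat) == (i.+1 * j.+1).-1 then X i j else 0))).
  apply: ler_sum => n _; rewrite dseriesME (@convE _ N)//.
  apply: (@le_trans _ _ ((\sum_(i < N) \sum_(j < N)
     nrm (if (i.+1 * j.+1 == n.+1)%N then a i * b j else 0)) * w n.+1)).
    rewrite ler_wpM2r//; apply: (le_trans (nrm_sum _ _ _)); apply: ler_sum => i _.
    exact: nrm_sum.
  rewrite mulr_suml; apply: ler_sum => i _; rewrite mulr_suml; apply: ler_sum => j _.
  have -> : ((n : nat) == (i.+1 * j.+1).-1) = (i.+1 * j.+1 == n.+1)%N by lia.
  case: ifPn => [/eqP <-|_]; last by rewrite nrm0 mul0r.
  rewrite /X mulrACA ler_pM ?nrm_ge0 ?nrmM//; last by have [_ _ ->] := hw.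
  exact: weight_ge0 (i.+1 * j.+1).-1.
rewrite exchange_big /=; apply: ler_sum => i _.
rewrite exchange_big /=; apply: ler_sum => j _.
by rewrite (sum_ord_pick _ _ (fun=> X i j)); case: ifP.
Qed.

Lemma wbdX a K m : wbd w a K -> wbd w (a ^+ m) (K ^+ m).
Proof.
move=> h; elim: m => [|m IH]; first by rewrite !expr0; exact: wbd1.
by rewrite !exprS; exact: wbdM.
Qed.

(** [L] is chosen so that the partial sum up to [L] is within [eps] of the supremum of all partial
    sums. *)
Lemma wbd_tail a K : wbd w a K -> forall eps, 0 < eps -> exists L, wbd w (a - trunc L a) eps.
Proof.
move=> h eps e0.
pose P N := \sum_(i < N) nrm (a i) * w i.+1.
have hs : has_sup (range P).
  by split; [exists (P 0%N), 0%N | exists K => _ [N _ <-]; exact: h].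
have [_ [L _ <-] hL] := sup_adherent e0 hs.
exists L => N.
have /(le_trans _) : P (maxn N L) - P L <= eps.
  have /ubP/(_ (P (maxn N L))) := sup_upper_bound hs; move=> /(_ _)/le_trans.
  have : P (maxn N L) <= sup (range P) by apply: ub_le_sup; [case: hs | exists (maxn N L)].
  lra.
apply; rewrite lerBrDr.
have hT M : \sum_(i < M) nrm ((a - trunc L a) i) * w i.+1 =
    \sum_(i < M) (if (i < L)%N then 0 else nrm (a i) * w i.+1).
  apply: eq_bigr => i _; rewrite dseriesBE /trunc; case: ifP => _.
    by rewrite subrr nrm0 mul0r.
  by rewrite subr0.
rewrite hT /P (big_ord_widen _ (fun i => nrm (a i) * w i.+1) (leq_maxr N L)).
rewrite (big_ord_widen _ (fun i => if (i < L)%N then 0 else nrm (a i) * w i.+1) (leq_maxl N L)).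
rewrite [X in X + _]big_mkcond [X in _ + X]big_mkcond -big_split /=.
apply: ler_sum => i _; have hi : 0 <= nrm (a i) * w i.+1 by rewrite mulr_ge0 ?nrm_ge0.
by case: ifP => _; case: ifP => _; rewrite ?addr0 ?add0r.
Qed.

Lemma wbd_trunc a K (L : nat) : wbd w a K -> wbd w (trunc L a) K.
Proof. by apply: wbd_dom => i; rewrite /trunc; case: ifP => // _; rewrite nrm0 nrm_ge0. Qed.

Lemma wbd_twist z a K : (forall n, complex.Re `|z n.+1| <= 1) -> wbd w a K -> wbd w (twist z a) K.
Proof. by move=> hz; apply: wbd_dom => i; rewrite nrmZ ler_piMl ?nrm_ge0. Qed.

(** The limit is taken coefficientwise in [A]; the weighted bound is then recovered on each finite
    range of indices, as in Fatou's lemma. *)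
Lemma wbd_complete (x : nat -> S) (C t : R) : 0 <= t -> t < 1 ->
  (forall m, wbd w (x m) (C * t ^+ m)) ->
  exists q : S, forall M, wbd w (q - \sum_(m < M) x m) (C * t ^+ M / (1 - t)).
Proof.
move=> t0 t1 hx; have C0 : 0 <= C by have := wbd_ge0 (hx 0%N); rewrite expr0 mulr1.
pose E k := C * t ^+ k / (1 - t); pose P k := \sum_(m < k) x m.
have hE eps : 0 < eps -> exists k, forall l, (k <= l)%N -> E l <= eps.
  move=> e0; have [|k hk] := geometric_small (C := C / (1 - t)) _ t0 t1 e0.
    by rewrite divr_ge0// subr_ge0 ltW.
  by exists k => l /hk; rewrite /E mulrAC.
have hP k l : (k <= l)%N -> wbd w (P l - P k) (E k).
  move=> kl.
  have -> : P l - P k = \sum_(i < l - k) x (k + i)%N.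
    have -> : P l = P k + \sum_(i < l - k) x (k + i)%N.
      by rewrite /P -[in LHS](subnKC kl) big_split_ord.
    by rewrite addrC addKr.
  have := @wbd_sum _ (index_enum 'I_(l - k)) xpredT _ _ (fun i _ => hx (k + i)%N).
  apply: wbd_le; rewrite /E -mulr_sumr -mulrA ler_wpM2l//.
  under eq_bigr do rewrite exprD.
  by rewrite -mulr_sumr ler_wpM2l ?exprn_ge0// sum_geometric_le.
have /choice[q hq] : forall n, exists y : V, forall k, nrm (y - P k n) <= E k.
  move=> n; apply: nrm_complete => [k l kl|eps /hE[k /(_ _ (leqnn k))]]; last by exists k.
  exact: wbd_coef (hP k l kl).
exists q => M N; rewrite -/(E M).
(* Each of the [N] coefficients is off by at most [E (maxn M k)], which costs [W] times that in
   weighted norm; [W + 1] avoids a zero denominator when [N = 0]. *)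
pose W := \sum_(i < N) w i.+1.
apply/ler_addgt0Pr => eps e0.
have W1 : 0 < W + 1 by rewrite ltr_wpDl// sumr_ge0.
have [k hk] := hE _ (divr_gt0 e0 W1).
have := hP M (maxn M k) (leq_maxl _ _) => /(_ N) h.
apply: (@le_trans _ _ (\sum_(i < N) (nrm ((P (maxn M k) - P M) i) * w i.+1 + E (maxn M k) * w i.+1))).
  apply: ler_sum => i _; rewrite -mulrDl ler_wpM2r//.
  rewrite !dseriesBE (le_trans (nrm_dist (P (maxn M k) i) _ _))// addrC lerD2l; exact: hq.
rewrite big_split /= lerD// -mulr_sumr -/W.
apply: (@le_trans _ _ (eps / (W + 1) * W)).
  by rewrite ler_wpM2r ?sumr_ge0// hk ?leq_maxr.
by rewrite mulrAC -mulrA ger_pMr// ler_pdivrMr// mul1r lerDl.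
Qed.

(** The factor [C] matters: geometric decay of the powers, that is spectral radius below 1, is
    enough, and the weighted norm of [h] itself may exceed 1. *)
Lemma neumann_series (h : S) (C t : R) : 0 <= t -> t < 1 ->
  (forall m, wbd w (h ^+ m) (C * t ^+ m)) ->
  exists q : S, (exists K, wbd w q K) /\ (1 - h) * q = 1.
Proof.
move=> t0 t1 hh; have [q hq] := wbd_complete t0 t1 hh.
have C0 : 0 <= C by have := wbd_ge0 (hh 0%N); rewrite expr0 mulr1.
exists q; split.
  by exists (C * t ^+ 0 / (1 - t)); have := hq 0%N; rewrite big_ord0 subr0.
have h1 : wbd w (1 - h) (1 + C * t).
  by apply: wbdB wbd1 _; have := hh 1%N; rewrite !expr1.
have key M : (1 - h) * q - 1 = (1 - h) * (q - \sum_(m < M) h ^+ m) - h ^+ M.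
  have := subrX1 h M; rewrite -[h - 1]opprB mulNr => /(congr1 -%R); rewrite opprK opprB => e.
  by rewrite mulrBr -e; ring.
apply/funext => n; apply/eqP; rewrite -subr_eq0; apply/eqP/nrm_eq0/eqP.
rewrite -dseriesBE eq_le nrm_ge0 andbT; apply/ler_addgt0Pr => eps e0; rewrite add0r.
have [|M hM] := geometric_small (C := (1 + C * t) * (C / (1 - t)) + C) _ t0 t1 e0.
  by rewrite addr_ge0// !mulr_ge0 ?invr_ge0 ?subr_ge0 ?addr_ge0 ?mulr_ge0// ltW.
apply: le_trans (hM M (leqnn M)); apply: wbd_coef; rewrite (key M).
have := wbdB (wbdM h1 (hq M)) (hh M); apply: wbd_le.
by rewrite [leRHS]mulrDl lerD2r -[leRHS]mulrA [X in _ <= _ * X]mulrAC.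
Qed.

End Weight.

Lemma twistB z a b : twist z (a - b) = twist z a - twist z b.
Proof. by apply/funext => i; rewrite /twist !dseriesBE scalerBr. Qed.

Lemma twistM z a b : cmult z -> twist z (a * b) = twist z a * twist z b.
Proof.
move=> [_ zM]; apply/funext => n; rewrite /twist !dseriesME /conv scaler_sumr.
apply: eq_bigr => i _; rewrite scaler_sumr; apply: eq_bigr => j _.
case: ifPn => [/eqP e|_]; last by rewrite scaler0.
have -> : z n.+1 = z i.+1 * z j.+1 by rewrite -zM// e.
by rewrite -scalerAl -scalerAr scalerA.
Qed.

Lemma twist1 z : cmult z -> twist z 1 = 1.
Proof.
move=> [z1 _]; apply/funext => n; rewrite /twist dseries1E.
by case: ifP => [/eqP ->|_]; rewrite ?scaler0// z1 scale1r.
Qed.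

End WeightedBound.

(** * Evaluation on the half-plane *)

Section PowerNeg.
Variable R : realType.
Local Open Scope complex_scope.
Implicit Types (s t : R[i]) (m n : nat).

Lemma npow_negE n s : npow_neg n s =
  let r := expR (- complex.Re s * ln n%:R) in let u := complex.Im s * ln n%:R in
  (r * cos u) +i* (- (r * sin u)).
Proof.
rewrite /npow_neg -complexiE; apply/eqP; rewrite eq_complex /=; apply/andP; split; apply/eqP; ring.
Qed.

Lemma npow_negD n s t : npow_neg n (s + t) = npow_neg n s * npow_neg n t.
Proof.
rewrite !npow_negE /=; case: s t => [a b] [c d] /=.
rewrite opprD !mulrDl expRD cosD sinD; apply/eqP; rewrite eq_complex /=.
by apply/andP; split; apply/eqP; ring.
Qed.

Lemma cmult_npow_neg s : cmult (fun n => npow_neg n s).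
Proof.
split=> [|m n m0 n0]; rewrite !npow_negE /=.
  by rewrite ln1 !mulr0 expR0 cos0 sin0 !mul1r oppr0.
rewrite natrM lnM ?posrE ?ltr0n// !mulrDr expRD cosD sinD; apply/eqP; rewrite eq_complex /=.
by apply/andP; split; apply/eqP; ring.
Qed.

Lemma Re_norm_npow_neg n s : complex.Re `|npow_neg n s| = expR (- complex.Re s * ln n%:R).
Proof.
rewrite npow_negE normc_def /=.
rewrite sqrrN !exprMn -mulrDr cos2Dsin2 mulr1 sqrtr_sqr ger0_norm// expR_ge0.
Qed.

Lemma Re_norm_npow_neg_le1 s n : halfplane s -> complex.Re `|npow_neg n.+1 s| <= 1.
Proof.
move=> hs; have {}hs : 0 <= complex.Re s := hs.
rewrite Re_norm_npow_neg -[leRHS]expR0 ler_expR mulNr oppr_le0 mulr_ge0//.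
by rewrite ln_ge0// ler1n.
Qed.

Lemma npow_neg_realE (x : R) n : npow_neg n x%:C = (expR (- x * ln n%:R))%:C.
Proof. by rewrite npow_negE/= mul0r cos0 sin0 mulr0 mulr1 oppr0. Qed.

End PowerNeg.

Lemma weight_cst1 (R : realType) : weight (fun=> 1 : R).
Proof. by split=> // *; rewrite mulr1. Qed.

Section Evaluation.
Variables (R : realType) (A : completeNormedModType R[i]) (B : comBanachAlg A).
Local Notation V := (alg_of B).
Local Notation S := (dseries V).
Local Notation one := (fun=> 1 : R).
Implicit Types (a b x : S) (K : R) (s : R[i]).

Definition total x : V := lim ((fun n => \sum_(i < n) x i : A) @ \oo).

Lemma totalP x K : wbd one x K -> forall eps, 0 < eps ->
  exists N, forall n, (N <= n)%N -> nrm (total x - \sum_(i < n) x i) <= eps.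
Proof.
move=> hx; pose P n := \sum_(i < n) nrm (x i).
have PK n : P n <= K by apply: le_trans (hx n); apply: ler_sum => i _; rewrite mulr1.
have hs : has_sup (range P).
  by split; [exists (P 0%N), 0%N | exists K => _ [N _ <-]; exact: PK].
(* The tail of the convergent real series of norms serves as Cauchy modulus. *)
have [||y hy] := nrm_complete (x := fun n => \sum_(i < n) x i) (e := fun k => sup (range P) - P k).
- move=> k l kl.
  have -> : \sum_(i < l) x i - \sum_(i < k) x i = \sum_(i < l - k) x (k + i)%N.
    have -> : \sum_(i < l) x i = \sum_(i < k) x i + \sum_(i < l - k) x (k + i)%N.
      by rewrite -[in LHS](subnKC kl) big_split_ord.
    by rewrite addrC addKr.
  have -> : sup (range P) - P k = \sum_(i < l - k) nrm (x (k + i)%N) + (sup (range P) - P l).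
    have -> : P l = P k + \sum_(i < l - k) nrm (x (k + i)%N).
      by rewrite /P -[in LHS](subnKC kl) big_split_ord.
    ring.
  apply: (le_trans (nrm_sum _ _ _)); rewrite lerDl subr_ge0.
  by apply: ub_le_sup; [case: hs | exists l].
- by move=> eps e0; have [_ [k _ <-] hk] := sup_adherent e0 hs; exists k; lra.
have hc eps : 0 < eps -> exists N, forall n, (N <= n)%N -> nrm (y - \sum_(i < n) x i) <= eps.
  move=> e0; have [_ [k _ <-] hk] := sup_adherent e0 hs; exists k => n kn.
  apply: (le_trans (hy n)).
  have : P k <= P n.
    rewrite /P (big_ord_widen _ (fun i => nrm (x i)) kn) big_mkcond /=.
    by apply: ler_sum => i _; case: ifP => // _; exact: nrm_ge0.
  lra.
have -> // : total x = y.
by apply/cvg_lim; [exact: norm_hausdorff | exact: nrm_cvg].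
Qed.

Lemma total_unique x K y : wbd one x K ->
  (forall eps, 0 < eps -> exists N, forall n, (N <= n)%N -> nrm (y - \sum_(i < n) x i) <= eps) ->
  total x = y.
Proof.
move=> hx hy; apply/cvg_lim; first exact: norm_hausdorff.
exact: nrm_cvg.
Qed.

Lemma nrm_total x K : wbd one x K -> nrm (total x) <= K.
Proof.
move=> hx; apply/ler_addgt0Pr => eps e0; have [N hN] := totalP hx e0.
have := nrm_dist (\sum_(i < N) x i) (total x) 0; rewrite !subr0 => h.
apply: (le_trans h); rewrite addrC lerD ?hN//; apply: (le_trans (nrm_sum _ _ _)).
by apply: le_trans (hx N); apply: ler_sum => i _; rewrite mulr1.
Qed.

Lemma totalD x y K L : wbd one x K -> wbd one y L -> total (x + y) = total x + total y.
Proof.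
move=> hx hy; apply: (total_unique (wbdD (@weight_cst1 R) hx hy)) => eps e0.
have e2 : 0 < eps / 2 by rewrite divr_gt0.
have [N hN] := totalP hx e2; have [M hM] := totalP hy e2.
exists (maxn N M) => n; rewrite geq_max => /andP[/hN h1 /hM h2].
have -> : \sum_(i < n) (x + y) i = \sum_(i < n) x i + \sum_(i < n) y i by rewrite -big_split.
rewrite opprD addrACA; apply: (le_trans (nrmD _ _)); lra.
Qed.

Lemma totalN x K : wbd one x K -> total (- x) = - total x.
Proof.
move=> hx; apply: (total_unique (wbdN (@weight_cst1 R) hx)) => eps e0.
have [N hN] := totalP hx e0; exists N => n /hN.
have -> : \sum_(i < n) (- x) i = - \sum_(i < n) x i by rewrite -sumrN.
by rewrite -opprD nrmN.
Qed.

Lemma totalB x y K L : wbd one x K -> wbd one y L -> total (x - y) = total x - total y.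
Proof.
move=> hx hy; rewrite (totalD hx (wbdN (@weight_cst1 R) hy)).
by rewrite (totalN hy).
Qed.

Lemma total_finite x K (L : nat) : wbd one x K -> (forall i, (L <= i)%N -> x i = 0) ->
  total x = \sum_(i < L) x i.
Proof.
move=> hx h; apply: (total_unique hx) => eps e0; exists L => n Ln.
by rewrite (sum_ord_widen Ln h) subrr nrm0 ltW.
Qed.

Lemma total_const (y : V) : total (constd y) = y.
Proof.
rewrite (@total_finite _ _ 1 (wbd_const (@weight_cst1 R) y)) ?big_ord1//.
by case.
Qed.

Lemma total1 : total 1 = 1. Proof. exact: total_const. Qed.

Lemma totalM_finite x y K K' (L : nat) : wbd one x K -> wbd one y K' ->
  (forall i, (L <= i)%N -> x i = 0) -> (forall i, (L <= i)%N -> y i = 0) ->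
  total (x * y) = total x * total y.
Proof.
move=> hx hy zx zy; have hxy := wbdM (@weight_cst1 R) hx hy.
(* Both supports lie among the integers 1 to [L], hence products lie among 1 to [L * L], and index
   [L * L] already stands for the next integer. *)
have zxy i : (L * L <= i)%N -> (x * y) i = 0.
  move=> Li; rewrite dseriesME /conv big1// => j _; rewrite big1// => k _.
  case: ifPn => // /eqP e.
  have [jL|/zx ->] := ltnP j L; last by rewrite mul0r.
  have [kL|/zy ->] := ltnP k L; last by rewrite mulr0.
  suff : (i.+1 <= i)%N by rewrite ltnn.
  by rewrite -{1}e (leq_trans _ Li)// leq_mul.
rewrite (total_finite hxy zxy) (total_finite hx zx) (total_finite hy zy).
set N := (L * L)%N.
have LN : (L <= N)%N by rewrite /N; case: (L) => // k; rewrite mulnS leq_addr.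
rewrite -(sum_ord_widen LN zx) -(sum_ord_widen LN zy) mulr_suml.
rewrite (eq_bigr (fun n : 'I_N => \sum_(i < N) \sum_(j < N)
   (if (n : nat) == (i.+1 * j.+1).-1 then x i * y j else 0))); last first.
  move=> n _; rewrite dseriesME (@convE _ N)//; apply: eq_bigr => i _; apply: eq_bigr => j _.
  by have -> : ((n : nat) == (i.+1 * j.+1).-1) = (i.+1 * j.+1 == n.+1)%N by lia.
rewrite exchange_big; apply: eq_bigr => i _ /=; rewrite mulr_sumr.
rewrite exchange_big; apply: eq_bigr => j _ /=.
rewrite (sum_ord_pick _ _ (fun=> x i * y j)); case: ltnP => // h.
have [iL|/zx ->] := ltnP i L; last by rewrite mul0r.
have [jL|/zy ->] := ltnP j L; last by rewrite mulr0.
suff : ((i.+1 * j.+1).-1 < N)%N by rewrite ltnNge h.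
by rewrite prednK// /N leq_mul.
Qed.

Lemma totalM x y K L : wbd one x K -> wbd one y L -> total (x * y) = total x * total y.
Proof.
move=> hx hy; have w1 := @weight_cst1 R.
have K0 := wbd_ge0 hx; have L0 := wbd_ge0 hy.
apply/eqP; rewrite -subr_eq0; apply/eqP/nrm_eq0/eqP.
rewrite eq_le nrm_ge0 andbT; apply/ler_addgt0Pr => eps e0; rewrite add0r.
(* The truncation errors will add up to [2 * d * (K + L)]; the [+ 1] keeps the denominator positive
   when both bounds vanish. *)
pose d := eps / (2 * (K + L + 1)).
have d0 : 0 < d by rewrite divr_gt0// mulr_gt0//; lra.
have [N1 h1] := wbd_tail w1 hx d0; have [N2 h2] := wbd_tail w1 hy d0.
set x' := trunc N1 x in h1; set y' := trunc N2 y in h2.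
have hx' : wbd one x' K := wbd_trunc w1 N1 hx. have hy' : wbd one y' L := wbd_trunc w1 N2 hy.
have e' : total (x' * y') = total x' * total y'.
  apply: (totalM_finite (L := maxn N1 N2) hx' hy') => i; rewrite geq_max => /andP[i1 i2];
  by rewrite /x' /y' /trunc ltnNge ?i1 ?i2.
have -> : x * y = x' * y' + ((x - x') * y + x' * (y - y')) by ring.
rewrite (totalD (wbdM w1 hx' hy') (wbdD w1 (wbdM w1 h1 hy) (wbdM w1 hx' h2))).
have -> : total x * total y =
    total x' * total y' + (total (x - x') * total y + total x' * total (y - y')).
  by rewrite (totalB hx hx') (totalB hy hy'); ring.
rewrite e' opprD addrACA subrr add0r.
apply: (@le_trans _ _ ((d * L + K * d) + (d * L + K * d))).
  apply: (le_trans (nrmB _ _)); apply: lerD.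
    exact: nrm_total (wbdD w1 (wbdM w1 h1 hy) (wbdM w1 hx' h2)).
  apply: (le_trans (nrmD _ _)); apply: lerD; apply: (le_trans (nrmM _ _)).
    by apply: ler_pM; rewrite ?nrm_ge0// ?(nrm_total hy) ?(nrm_total h1).
  by apply: ler_pM; rewrite ?nrm_ge0// ?(nrm_total hx') ?(nrm_total h2).
have -> : (d * L + K * d) + (d * L + K * d) = eps * ((K + L) / (K + L + 1)).
  rewrite /d; field; lra.
rewrite ger_pMr// ler_pdivrMr; lra.
Qed.

Definition ev a s : V := total (twist (fun n => npow_neg n s) a).

Section EvWeight.
Variable w : nat -> R.
Hypothesis hw : weight w.
Variable s : R[i].
Hypothesis hs : halfplane s.

Lemma wbd_twist_npow a K : wbd w a K -> wbd w (twist (fun n => npow_neg n s) a) K.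
Proof. by apply: wbd_twist => // n; exact: Re_norm_npow_neg_le1. Qed.

Lemma wbd_ev a K : wbd w a K -> wbd one (twist (fun n => npow_neg n s) a) K.
Proof. by move=> h; apply: (wbd_unweight hw); exact: wbd_twist_npow. Qed.

Lemma nrm_ev a K : wbd w a K -> nrm (ev a s) <= K.
Proof. by move=> /wbd_ev; exact: nrm_total. Qed.

Lemma evB a b K L : wbd w a K -> wbd w b L -> ev (a - b) s = ev a s - ev b s.
Proof. by move=> /wbd_ev ha /wbd_ev hb; rewrite /ev twistB (totalB ha hb). Qed.

Lemma evM a b K L : wbd w a K -> wbd w b L -> ev (a * b) s = ev a s * ev b s.
Proof.
move=> /wbd_ev ha /wbd_ev hb; rewrite /ev twistM ?(totalM ha hb)//.
exact: cmult_npow_neg.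
Qed.

Lemma ev1 : ev 1 s = 1.
Proof. by rewrite /ev twist1 ?total1//; exact: cmult_npow_neg. Qed.

Lemma evX a K m : wbd w a K -> ev (a ^+ m) s = ev a s ^+ m.
Proof.
move=> h; elim: m => [|m IH]; first by rewrite !expr0 ev1.
by rewrite !exprS (evM h (wbdX hw m h)) IH.
Qed.

Lemma ev_const y : ev (constd y) s = y.
Proof.
rewrite /ev (_ : twist _ _ = constd y) ?total_const//; apply/funext => i; rewrite /twist /constd.
have [z1 _] := cmult_npow_neg s.
by case: ifP => [/eqP ->|_]; rewrite ?scaler0// z1 scale1r.
Qed.

Lemma ev_trunc a K (L : nat) : wbd w a K ->
  ev (trunc L a) s = \sum_(i < L) npow_neg i.+1 s *: a i.
Proof.
move=> h; rewrite /ev (total_finite (L := L) (wbd_ev (wbd_trunc hw L h))); last first.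
  by move=> i Li; rewrite /twist /trunc ltnNge Li scaler0.
by apply: eq_bigr => i _; rewrite /twist /trunc ltn_ord.
Qed.

Lemma dirichlet_ev (c : nat -> A) K : wbd w ((fun i => c i.+1) : S) K ->
  dirichlet c s = ev ((fun i => c i.+1) : S) s.
Proof.
move=> h; rewrite /dirichlet; apply/cvg_lim; first exact: norm_hausdorff.
apply: nrm_cvg => eps e0; have [N hN] := totalP (wbd_ev h) e0.
exists N.+1 => -[//|n]; rewrite ltnS => /hN.
by rewrite big_add1 big_mkord.
Qed.

End EvWeight.
End Evaluation.

(** * The spectral radius *)

Section CoefficientBound.
Variables (R : realType) (A : completeNormedModType R[i]) (B : comBanachAlg A).
Local Notation V := (alg_of B).
Local Notation S := (dseries V).

Lemma norm_sum_unit_powers (r : R[i]) T : `|r| = 1 -> r != 1 ->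
  `|\sum_(k < T) r ^+ k| <= 2 / `|r - 1|.
Proof.
move=> r1 rn1; have r10 : 0 < `|r - 1| by rewrite normr_gt0 subr_eq0.
rewrite ler_pdivlMr// -normrM mulrC -subrX1.
by apply: (le_trans (ler_normB _ _)); rewrite normrX r1 expr1n normr1.
Qed.

(* Averaging [z n ^- k *: sum_i z i ^+ k *: q i] over [k < T] isolates [q n] as [T] grows:
   the other terms are geometric sums, bounded independently of [T]. *)
Lemma coef_le_unit_powers (N : nat) (z : nat -> R[i]) (q : nat -> V) (M : R) n :
  (forall i, `|z i| = 1) -> (n < N)%N ->
  (forall i, (i < N)%N -> i != n -> z i != z n) ->
  (forall k, nrm (\sum_(i < N) z i ^+ k *: q i) <= M) -> nrm (q n) <= M.
Proof.
move=> z1 nN zN hM.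
pose r i := z i / z n.
have zn0 : z n != 0 by rewrite -normr_gt0 z1.
have r1 i : `|r i| = 1 by rewrite /r normrM normfV !z1 invr1 mulr1.
pose D := \sum_(i < N) complex.Re (2 / `|r i - 1|) * nrm (q i).
have D0 : 0 <= D.
  apply: sumr_ge0 => i _; rewrite mulr_ge0 ?nrm_ge0//.
  have : 0 <= 2 / `|r i - 1| by rewrite divr_ge0.
  by rewrite lecE => /andP[].
have key T : T%:R * nrm (q n) <= T%:R * M + D.
  pose Q k := \sum_(i < N) z i ^+ k *: q i.
  have e : \sum_(k < T) (z n)^-1 ^+ k *: Q k =
      T%:R *: q n + \sum_(i < N | (i : nat) != n) (\sum_(k < T) r i ^+ k) *: q i.
    transitivity (\sum_(i < N) (\sum_(k < T) r i ^+ k) *: q i).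
      under eq_bigr do rewrite scaler_sumr.
      rewrite exchange_big; apply: eq_bigr => i _ /=; rewrite scaler_suml.
      by apply: eq_bigr => k _; rewrite scalerA -exprMn mulrC.
    rewrite (bigD1 (Ordinal nN)) //=; congr (_ + _).
    congr (_ *: _); rewrite /r divff//.
    under eq_bigr do rewrite expr1n.
    by rewrite sumr_const card_ord.
  have h1 : nrm (\sum_(k < T) (z n)^-1 ^+ k *: Q k) <= T%:R * M.
    apply: (le_trans (nrm_sum _ _ _)).
    apply: (@le_trans _ _ (\sum_(k < T) M)); last by rewrite sumr_const card_ord mulr_natl.
    apply: ler_sum => k _; rewrite nrmZ normrX normfV z1 invr1 expr1n mul1r; exact: hM.
  have h2 : nrm (\sum_(i < N | (i : nat) != n) (\sum_(k < T) r i ^+ k) *: q i) <= D.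
    apply: (le_trans (nrm_sum _ _ _)); rewrite /D big_mkcond /=.
    apply: ler_sum => i _; case: ifPn => hi; last first.
      rewrite mulr_ge0 ?nrm_ge0//.
      have : 0 <= 2 / `|r i - 1| by rewrite divr_ge0.
      by rewrite lecE => /andP[].
    rewrite nrmZ ler_wpM2r ?nrm_ge0//.
    have : `|\sum_(k < T) r i ^+ k| <= 2 / `|r i - 1|.
      apply: norm_sum_unit_powers => //.
      apply: contra (zN i (ltn_ord i) hi) => /eqP ri1.
      by rewrite -[z i](divfK zn0) -/(r i) ri1 mul1r.
    by rewrite lecE => /andP[].
  have -> : T%:R * nrm (q n) = nrm (T%:R *: q n).
    rewrite nrmZ; congr (_ * _); rewrite normr_nat.
    by rewrite -(rmorph_nat (real_complex R)).
  have -> : T%:R *: q n = \sum_(k < T) (z n)^-1 ^+ k *: Q k -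
     \sum_(i < N | (i : nat) != n) (\sum_(k < T) r i ^+ k) *: q i by rewrite e addrK.
  exact: le_trans (nrmB _ _) (lerD h1 h2).
apply/ler_addgt0Pr => eps e0.
pose T := Num.bound (D / eps).
have hT : D / eps < T%:R by apply: archi_boundP; rewrite divr_ge0// ltW.
have T0 : 0 < T%:R :> R by apply: le_lt_trans hT; rewrite divr_ge0// ltW.
rewrite -(ler_pM2l T0); apply: (le_trans (key T)); rewrite mulrDr lerD2l.
by rewrite -ler_pdivrMr// ltW.
Qed.

Variable w : nat -> R.
Hypothesis hw : weight w.

Lemma npow_negMn n (s : R[i]) k : npow_neg n (s *+ k) = npow_neg n s ^+ k.
Proof.
elim: k => [|k IH].
  rewrite mulr0n expr0 npow_negE /= oppr0 !mul0r expR0 cos0 sin0 mul1r mulr0 oppr0.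
  by [].
by rewrite mulrS exprS npow_negD IH.
Qed.

(** The averaging runs over the multiples [s *+ k] of one small imaginary number, and the part of
    [q] beyond [N] changes its values by at most [eps]. *)
Lemma coef_le_sup (q : S) K M : wbd w q K ->
  (forall s, halfplane s -> nrm (ev q s) <= M) -> forall n, nrm (q n) <= M.
Proof.
move=> hq hM n; apply/ler_addgt0Pr => eps e0.
have [L hL] := wbd_tail hw hq e0.
pose N := maxn L n.+1.
(* With step [1 / N] the angles [ln (i.+1) / N] for [i < N] lie in [[0, 1]], inside [[0, pi]] where
   the cosine is injective; hence the unit numbers [z i] are distinct. *)
pose s : R[i] := (0 +i* (N%:R)^-1)%C.
have N0 : 0 < N%:R :> R by rewrite ltr0n /N leq_max ltnS leq0n orbT.
pose z i := npow_neg i.+1 s.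
have ln_in i : (i < N)%N -> (N%:R)^-1 * ln (i.+1%:R : R) \in `[0, pi].
  move=> iN; rewrite in_itv /= mulr_ge0 ?invr_ge0 ?ler0n ?ln_ge0 ?ler1n//=.
  apply: (@le_trans _ _ 1); last by have := pi_ge2 R; lra.
  rewrite mulrC ler_pdivrMr// mul1r.
  apply: (@le_trans _ _ (i.+1%:R)); last by rewrite ler_nat.
  by apply/ltW/ln_sublinear; rewrite ltr0n.
have hs k : halfplane (s *+ k).
  rewrite /halfplane /=.
  suff -> : complex.Re (s *+ k) = 0 by [].
  by elim: k => // k; rewrite mulrS; case: (s *+ k) => x y /= ->; rewrite add0r.
have hN : wbd w (q - trunc N q) eps.
  apply: (wbd_dom hw) hL => i; rewrite !dseriesBE /trunc.
  case: (ltnP i N) => iN; first by rewrite subrr nrm0 nrm_ge0.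
  by rewrite ltnNge (leq_trans (leq_maxl L n.+1) iN).
apply: (@coef_le_unit_powers N z q) => //.
- move=> i; rewrite -[LHS]RRe_real ?ger0_real// Re_norm_npow_neg /=.
  by rewrite oppr0 mul0r expR0.
- by rewrite /N leq_max ltnSn orbT.
- move=> i iN; apply: contra => /eqP; rewrite /z !npow_negE /= oppr0 !mul0r expR0 !mul1r.
  move=> [/cos_inj h _]; have nN : (n < N)%N by rewrite /N leq_max ltnSn orbT.
  have Ni0 : (N%:R : R)^-1 != 0 by rewrite invr_eq0 gt_eqF.
  have /ln_inj := mulfI Ni0 (h (ln_in _ iN) (ln_in _ nN)).
  by rewrite !posrE !ltr0n => /(_ erefl erefl)/eqP; rewrite eqr_nat eqSS.
- move=> k; under eq_bigr do rewrite /z -npow_negMn.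
  rewrite -(ev_trunc hw (hs k) N hq).
  have -> : trunc N q = q - (q - trunc N q) by rewrite opprB addrC subrK.
  rewrite (evB hw (hs k) hq hN); apply: (le_trans (nrmB _ _)).
  by rewrite lerD ?hM// (nrm_ev hw (hs k) hN).
Qed.

End CoefficientBound.

Section SpectralBound.
Variables (R : realType) (A : completeNormedModType R[i]) (B : comBanachAlg A).
Local Notation V := (alg_of B).
Local Notation S := (dseries V).
Variable w : nat -> R.
Hypotheses (hw : weight w) (aw : admissible w).

(** Admissibility gives [w (l.+1 ^ k) <= rho ^+ k] for all large [k]; the constant absorbs the
    finitely many remaining exponents. *)
Lemma admissible_le l (rho : R) : 1 < rho ->
  exists2 C, 0 <= C & forall k, w (l.+1 ^ k)%N <= C * rho ^+ k.
Proof.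
move=> r1; have w0 k : 0 <= w (l.+1 ^ k)%N.
  by rewrite -(prednK (n := l.+1 ^ k)) ?expn_gt0//; exact: weight_ge0.
have /cvgrPdist_le/(_ (rho - 1)) := aw (ltn0Sn l); rewrite subr_gt0 => /(_ r1)[N _ hN].
pose D := \sum_(k < N.+1) w (l.+1 ^ k)%N.
have D0 : 0 <= D by apply: sumr_ge0.
exists (1 + D) => [|k]; first by rewrite addr_ge0.
have rk1 : 1 <= rho ^+ k by rewrite exprn_ege1// ltW.
(* Splitting at [N.+1] rather than [N] makes [k] positive in the second case, where the [k]-th root
   is undone. *)
have [kN|Nk] := ltnP k N.+1.
  apply: (@le_trans _ _ D).
    by rewrite /D (bigD1 (Ordinal kN))//= lerDl sumr_ge0.
  by rewrite -[leLHS]mulr1 ler_pM// lerDr.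
apply: (@le_trans _ _ (rho ^+ k)); last by rewrite ler_peMl ?lerDl// (le_trans ler01).
have /= := hN k (ltnW Nk); rewrite ler_norml => /andP[h _].
have {}h : w (l.+1 ^ k)%N `^ k%:R^-1 <= rho by lra.
have k0 : k%:R != 0 :> R by rewrite pnatr_eq0; case: k Nk {rk1 h}.
rewrite -[leLHS](powRr1 (w0 k)) -(mulVf k0) powRrM powR_mulrn ?powR_ge0//.
by rewrite lerXn2r// ?nnegrE ?powR_ge0// (le_trans _ (ltW r1)).
Qed.

Lemma weight_prod (I : finType) (F : I -> nat) : (forall i, 0 < F i)%N ->
  w (\prod_i F i)%N <= \prod_i w (F i).
Proof.
move=> F0; have [w1 w11 wM] := hw.
suff : (0 < \prod_i F i)%N /\ w (\prod_i F i)%N <= \prod_i w (F i) by case.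
elim/big_rec2: _ => [|i y x _ [x0 hx]]; first by rewrite w11.
split; first by rewrite muln_gt0 F0.
apply: (le_trans (wM _ _ _ _)) => //; apply: ler_wpM2l => //.
exact: le_trans ler01 (w1 _ (F0 i)).
Qed.

(** [al l] counts how often [l.+1] is chosen among the [i] factors. *)
Lemma exp_support (L : nat) (p : S) i n : (forall j, (L <= j)%N -> p j = 0) ->
  (p ^+ i) n != 0 ->
  exists al : 'I_L -> nat, (forall l, al l <= i)%N /\ n.+1 = (\prod_(l < L) l.+1 ^ al l)%N.
Proof.
move=> hp; elim: i n => [|i IH] n.
  rewrite expr0 dseries1E; case: ifPn => [/eqP -> _|_]; last by rewrite eqxx.
  by exists (fun=> 0%N); split => //; rewrite big1.
rewrite exprS dseriesME /conv => h.
have [j [k [jk pj pk]]] : exists j k, [/\ (j.+1 * k.+1 = n.+1)%N, p j != 0 & (p ^+ i) k != 0].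
  apply: contrapT => hn; move/eqP: h; apply.
  apply: big1 => j _; apply: big1 => k _; case: ifPn => // /eqP e.
  have [->|pj] := eqVneq (p j) 0; first by rewrite mul0r.
  have [->|pk] := eqVneq ((p ^+ i) k) 0; first by rewrite mulr0.
  by case: hn; exists j, k.
have jL : (j < L)%N by rewrite ltnNge; apply: contra pj => /hp ->.
have [al [al1 al2]] := IH _ pk.
exists (fun l => al l + (l == Ordinal jL))%N; split.
  by move=> l; rewrite -addn1 leq_add// leq_b1.
rewrite -jk al2; under [RHS]eq_bigr do rewrite expnD.
rewrite big_split /= mulnC; congr muln.
rewrite (bigD1 (Ordinal jL))//= eqxx expn1 big1 ?muln1// => l /negbTE ->.
exact: expn0.
Qed.

(** The sum over integers is replaced by a sum over exponent vectors. An integer with several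
    representations is counted repeatedly, which only enlarges the bound, and submultiplicativity of
    [w] splits the sum into a product over [l]. *)
Lemma exp_wbd_coef (L : nat) (p : S) i M : (forall j, (L <= j)%N -> p j = 0) ->
  0 <= M -> (forall n, nrm ((p ^+ i) n) <= M) ->
  wbd w (p ^+ i) (M * \prod_(l < L) \sum_(a < i.+1) w (l.+1 ^ a)%N).
Proof.
move=> hp M0 hM N.
pose T := {ffun 'I_L -> 'I_i.+1}; pose P (al : T) := (\prod_(l < L) l.+1 ^ al l)%N.
have P0 al : (0 < P al)%N by apply: prodn_gt0 => l; rewrite expn_gt0.
apply: (@le_trans _ _ (\sum_(n < N) \sum_(al : T) if (n : nat) == (P al).-1 then M * w (P al) else 0)).
  apply: ler_sum => n _.
  have pos al : 0 <= (if (n : nat) == (P al).-1 then M * w (P al) else 0).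
    by case: ifP => // _; rewrite mulr_ge0// -(prednK (P0 al)) weight_ge0.
  have [->|nz] := eqVneq ((p ^+ i) n) 0.
    by rewrite nrm0 mul0r sumr_ge0.
  have [al [al1 al2]] := exp_support hp nz.
  pose be : T := [ffun l => inord (al l)].
  have Pbe : P be = n.+1.
    by rewrite al2; apply: eq_bigr => l _; rewrite ffunE inordK// ltnS.
  rewrite (bigD1 be)//= Pbe eqxx; apply: ler_wpDr; first exact: sumr_ge0.
  by rewrite ler_wpM2r// weight_ge0.
rewrite exchange_big /=.
apply: (@le_trans _ _ (\sum_(al : T) M * \prod_(l < L) w (l.+1 ^ al l)%N)).
  apply: ler_sum => al _; rewrite (sum_ord_pick _ _ (fun=> M * w (P al))).
  have h : M * w (P al) <= M * \prod_(l < L) w (l.+1 ^ al l)%N.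
    by rewrite ler_wpM2l// weight_prod// => l; rewrite expn_gt0.
  case: ifP => // _; apply: le_trans h.
  by rewrite mulr_ge0// -(prednK (P0 al)) weight_ge0.
by rewrite -mulr_sumr -(bigA_distr_bigA (fun (l : 'I_L) (a : 'I_i.+1) => w (l.+1 ^ a)%N)).
Qed.

(** The constant depends on [L] and [d] but not on the exponent [i], so the growth rate is the
    supremum bound up to the factor [1 + d]. *)
Lemma polynomial_power_wbd (L : nat) (d : R) : 0 < d ->
  exists C, forall (p : S) M, (forall j, (L <= j)%N -> p j = 0) ->
    0 <= M -> (exists K, wbd w p K) -> (forall s, halfplane s -> nrm (ev p s) <= M) ->
    forall i, wbd w (p ^+ i) (C * (M * (1 + d)) ^+ i).
Proof.
(* [rho] is the [L.+1]-th root of [1 + d], so the [L] factors together cost at most [1 + d] per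
   power; [L.+1] covers [L = 0]. *)
move=> d0; pose rho := expR (ln (1 + d) / L.+1%:R).
have rho1 : 1 < rho.
  by rewrite expR_gt1 divr_gt0// ln_gt0; lra.
have rhoL : rho ^+ L <= 1 + d.
  apply: (@le_trans _ _ (rho ^+ L.+1)).
    by rewrite exprS ler_peMl ?exprn_ge0// ltW// (lt_trans ltr01).
  by rewrite /rho -expRM_natr divfK ?pnatr_eq0// lnK// posrE; lra.
have /choice[c hc] : forall l, exists C, 0 <= C /\ forall k, w (l.+1 ^ k)%N <= C * rho ^+ k.
  by move=> l; have [C C0 hC] := admissible_le l rho1; exists C.
(* The geometric sum of [rho ^+ a] over [a <= i] is at most [rho / (rho - 1) * rho ^+ i]. *)
pose c' l := c l * (rho / (rho - 1)).
have c'0 l : 0 <= c' l.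
  have [? _] := hc l; rewrite !mulr_ge0// ?invr_ge0 ?subr_ge0 ltW//.
  exact: lt_trans rho1.
exists (\prod_(l < L) c' l) => p M hp M0 [K hK] hM i.
have pM n : nrm ((p ^+ i) n) <= M ^+ i.
  apply: (coef_le_sup hw (wbdX hw i hK)) => s hs; rewrite (evX hw hs _ hK).
  elim: i => [|i IH]; first by rewrite !expr0 nrm1.
  rewrite !exprS; apply: (le_trans (nrmM _ _)); apply: ler_pM; rewrite ?nrm_ge0//; exact: hM.
apply: wbd_le (exp_wbd_coef hp (exprn_ge0 i M0) pM).
rewrite [in leRHS]exprMn mulrCA ler_wpM2l ?exprn_ge0//.
apply: (@le_trans _ _ (\prod_(l < L) (c' l * rho ^+ i))).
  apply: ler_prod => l _; have [c0 hcl] := hc l; apply/andP; split.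
    by apply: sumr_ge0 => a _; rewrite -(prednK (n := l.+1 ^ a)) ?expn_gt0// weight_ge0.
  apply: (@le_trans _ _ (\sum_(a < i.+1) c l * rho ^+ a)).
    by apply: ler_sum => a _.
  rewrite -mulr_sumr /c' -mulrA ler_wpM2l//.
  rewrite mulrAC ler_pdivlMr ?subr_gt0// mulrC -subrX1 -exprS lerBlDr lerDl.
  exact: ler01.
rewrite big_split /= ler_wpM2l ?prodr_ge0//.
by rewrite prodr_const card_ord -exprM mulnC exprM lerXn2r//
  nnegrE ?exprn_ge0 ?addr_ge0// ltW// (lt_trans ltr01).
Qed.

(** Split [v] into a polynomial [p] and a remainder of weighted norm at most [e1]. Powers of [p]
    grow at rate [(M + e1) * (1 + d)], powers of the remainder at rate [e1], and the binomial
    theorem adds the two rates. *)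
Lemma spectral_bound (v : S) K M M' : wbd w v K -> 0 <= M -> M < M' ->
  (forall s, halfplane s -> nrm (ev v s) <= M) ->
  exists C, forall m, wbd w (v ^+ m) (C * M' ^+ m).
Proof.
move=> hv M0 MM' hM.
(* These values solve [e1 + (M + e1) * (1 + d) = M'] exactly. *)
pose e1 := (M' - M) / 4; pose d := (M' - M) / (2 * (M + e1)).
have e10 : 0 < e1 by rewrite /e1; lra.
have d0 : 0 < d by rewrite divr_gt0// ?mulr_gt0//; lra.
have eM : e1 + (M + e1) * (1 + d) = M' by rewrite /d /e1; field; lra.
have [L hL] := wbd_tail hw hv e10; set p := trunc L v in hL.
have hp := wbd_trunc hw L hv; rewrite -/p in hp.
have [C hC] := polynomial_power_wbd L d0.
have {}hC : forall i, wbd w (p ^+ i) (C * ((M + e1) * (1 + d)) ^+ i).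
  apply: hC; [|by rewrite addr_ge0// ltW|by exists K|].
    by move=> j Lj; rewrite /p /trunc ltnNge Lj.
  move=> s hs; have -> : p = v - (v - p) by rewrite opprB addrC subrK.
  rewrite (evB hw hs hv hL); apply: (le_trans (nrmB _ _)).
  by rewrite lerD ?hM// (nrm_ev hw hs hL).
exists C => m; rewrite -(subrK p v) -eM !exprDn mulr_sumr; apply: wbd_sum => // i _.
rewrite mulrnAr mulrCA; apply: wbdMn => //.
exact (wbdM hw (wbdX hw (m - i) hL) (hC i)).
Qed.

End SpectralBound.

(** * Inversion *)

Section Perturbation.
Variables (R : realType) (A : completeNormedModType R[i]) (B : comBanachAlg A).
Local Notation V := (alg_of B).
Local Notation S := (dseries V).

Lemma constdM (x : V) (b : S) : constd x * b = fun n => x * b n.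
Proof. exact: conv_constd. Qed.

Lemma inv_unique (T : comNzRingType) (x y z : T) : x * y = 1 -> x * z = 1 -> y = z.
Proof. by move=> xy xz; rewrite -[y]mulr1 -xz mulrA [y * x]mulrC xy mul1r. Qed.

Lemma neumann (h : V) : nrm h <= 2^-1 -> exists2 q, (1 - h) * q = 1 & nrm q <= 2.
Proof.
move=> h2; have w1 := @weight_cst1 R.
(* [A] embeds as the constant series, so the inverse in [A] is read off as coefficient 0 of the
   Neumann series. *)
have [||m|q [_ hq]] := @neumann_series R A B _ w1 (constd h) 1 (nrm h).
- exact: nrm_ge0.
- by apply: le_lt_trans h2 _; lra.
- by rewrite mul1r; exact: wbdX (wbd_const w1 h).
have e : (1 - h) * q 0%N = 1.
  move/(congr1 (fun x : S => x 0%N)): hq.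
  by rewrite mulrBl mul1r constdM dseriesBE dseries1E /= mulrBl mul1r.
exists (q 0%N) => //.
have eq0 : q 0%N = 1 + h * q 0%N by rewrite -e; ring.
have : nrm (q 0%N) <= 1 + 2^-1 * nrm (q 0%N).
  rewrite [in leLHS]eq0; apply: (le_trans (nrmD _ _)); rewrite nrm1 lerD2l.
  by apply: (le_trans (nrmM _ _)); rewrite ler_wpM2r ?nrm_ge0.
lra.
Qed.

(** The explicit bound on [y'] says that inverses stay uniformly bounded near an invertible point,
    which is what contradicts a blow-up in [bounded_inverse]. *)
Lemma perturb_inverse (x x' y : V) : x * y = 1 -> nrm (x - x') * nrm y <= 2^-1 ->
  exists2 y', x' * y' = 1 & nrm y' <= 2 * nrm y.
Proof.
move=> xy h; have [|q hq q2] := @neumann (y * (x - x')).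
  by apply: le_trans (nrmM _ _) _; rewrite mulrC.
have e : x' = x * (1 - y * (x - x')) by rewrite mulrBr mulrA xy; ring.
exists (y * q); first by rewrite e -[RHS]hq -[RHS]mul1r -xy; ring.
by apply: le_trans (nrmM _ _) _; rewrite mulrC ler_wpM2r ?nrm_ge0.
Qed.

Variable w : nat -> R.
Hypotheses (hw : weight w) (aw : admissible w).

(* Newman's argument: the powers of [v * (u - u')] are controlled by the supremum norm of [v],
   not by its weighted norm, so the admissible size of [u - u'] depends only on [M]. *)
Lemma inverse_step (u u' v : S) Ku Kv M d : wbd w u Ku -> wbd w v Kv -> u * v = 1 ->
  0 <= M -> (forall s, halfplane s -> nrm (ev v s) <= M) ->
  wbd w (u - u') d -> d * M < 1 ->
  exists v', (exists K, wbd w v' K) /\ u' * v' = 1.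
Proof.
move=> hu hv uv M0 hM hd dM; have d0 := wbd_ge0 hd.
(* Any [M'] above [M] with [M' * d < 1] would do; dividing by [d + 1] covers [d = 0]. *)
pose M' := M + (1 - d * M) / (d + 1).
have e0 : 0 < (1 - d * M) / (d + 1) by rewrite divr_gt0 ?subr_gt0//; lra.
have MM' : M < M' by rewrite ltrDl.
have dM' : M' * d < 1.
  rewrite /M' mulrDl [M * d]mulrC -ltrBrDl mulrAC -mulrA gtr_pMr ?subr_gt0//.
  by rewrite ltr_pdivrMr; lra.
have [C hC] := spectral_bound hw aw hv M0 MM' hM.
pose h := v * (u - u').
have [|m|q [[K hK] hq]] := neumann_series hw (h := h) (C := C) _ dM'.
- by rewrite mulr_ge0// (le_trans M0)// ltW.
- by rewrite /h !exprMn mulrA; exact (wbdM hw (hC m) (wbdX hw m hd)).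
exists (v * q); split; first by exists (Kv * K); exact (wbdM hw hv hK).
have -> : u' = u * (1 - h) by rewrite /h mulrBr mulrA uv; ring.
by rewrite -[RHS]hq -[RHS]mul1r -uv; ring.
Qed.

Lemma wbd_scale (x a : S) c K : 0 <= c -> (forall i, nrm (x i) <= c * nrm (a i)) ->
  wbd w a K -> wbd w x (c * K).
Proof.
move=> c0 hx ha N; apply: (@le_trans _ _ (c * \sum_(i < N) nrm (a i) * w i.+1)).
  rewrite mulr_sumr; apply: ler_sum => i _; rewrite mulrA ler_wpM2r//; exact: weight_ge0.
by rewrite ler_wpM2l// ha.
Qed.

Lemma wbd_finite (x : S) (L : nat) : (forall i, (L <= i)%N -> x i = 0) ->
  wbd w x (\sum_(i < L) nrm (x i) * w i.+1).
Proof.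
move=> hx N; rewrite -(sum_ord_widen (leq_maxl L N) (G := fun i => nrm (x i) * w i.+1)); last first.
  by move=> i /hx ->; rewrite nrm0 mul0r.
rewrite (big_ord_widen _ (fun i => nrm (x i) * w i.+1) (leq_maxr L N)) big_mkcond /=.
apply: ler_sum => i _; case: ifP => // _; rewrite mulr_ge0 ?nrm_ge0//; exact: weight_ge0.
Qed.

End Perturbation.

(** * Deformation along horizontal translates *)

Section Path.
Variables (R : realType) (A : completeNormedModType R[i]) (B : comBanachAlg A).
Local Notation V := (alg_of B).
Local Notation S := (dseries V).
Variable w : nat -> R.
Hypotheses (hw : weight w) (aw : admissible w).
Variables (a : S) (K : R).
Hypothesis ha : wbd w a K.

Definition shift (sigma : R) : S := twist (fun n => npow_neg n sigma%:C%C) a.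

Lemma halfplane_real (sigma : R) : 0 <= sigma -> halfplane sigma%:C%C.
Proof. by []. Qed.

Lemma wbd_shift sigma : 0 <= sigma -> wbd w (shift sigma) K.
Proof. by move=> s0; exact: wbd_twist_npow. Qed.

Lemma shiftE sigma i : shift sigma i = (expR (- sigma * ln i.+1%:R))%:C%C *: a i.
Proof. by rewrite /shift /twist npow_neg_realE. Qed.

Lemma shift0 : shift 0 = a.
Proof. by apply/funext => i; rewrite shiftE oppr0 mul0r expR0 scale1r. Qed.

Lemma ev_shift sigma s : ev (shift sigma) s = ev a (s + sigma%:C%C).
Proof.
rewrite /ev; congr total; apply/funext => i.
by rewrite /shift /twist scalerA -npow_negD.
Qed.

Lemma nrm_realZ (r : R) (x : V) : nrm (r%:C%C *: x) = `|r| * nrm x.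
Proof. by rewrite nrmZ normc_def /= expr0n /= addr0 sqrtr_sqr. Qed.

Lemma expR_dist (x y t : R) : 0 <= x -> 0 <= y -> 0 <= t ->
  `|expR (- (x + y) * t) - expR (- x * t)| <= y * t.
Proof.
move=> x0 y0 t0.
have e1 : expR (- (y * t)) <= 1 by rewrite -expR0 ler_expR oppr_le0 mulr_ge0.
have e2 : expR (- x * t) <= 1 by rewrite -expR0 ler_expR mulNr oppr_le0 mulr_ge0.
have -> : expR (- (x + y) * t) = expR (- x * t) * expR (- (y * t)).
  by rewrite -expRD; congr expR; ring.
rewrite distrC ger0_norm; last by rewrite subr_ge0 ler_piMr// expR_ge0.
have := expR_ge1Dx (- (y * t)) => h.
have : expR (- x * t) * (1 - expR (- (y * t))) <= 1 * (y * t).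
  by apply: ler_pM; rewrite ?expR_ge0//; lra.
lra.
Qed.

(** Twisting does not increase weighted norms, so the tail is small whatever [sigma] is; on the
    first [L] coefficients the frequencies are bounded and the dependence on [sigma] is Lipschitz
    with constant [D]. *)
Lemma shift_uniform d : 0 < d -> exists2 eta, 0 < eta &
  forall sigma, 0 <= sigma -> wbd w (shift (sigma + eta) - shift sigma) d.
Proof.
move=> d0; have d4 : 0 < d / 4 by lra.
have [L hL] := wbd_tail hw ha d4; set p := trunc L a in hL.
pose D := \sum_(i < L) ln (i.+1%:R : R) * (nrm (a i) * w i.+1).
have D0 : 0 <= D.
  apply: sumr_ge0 => i _; rewrite !mulr_ge0 ?nrm_ge0 ?ln_ge0 ?ler1n//; exact: weight_ge0.
pose eta := d / 2 / (D + 1).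
have eta0 : 0 < eta by rewrite !divr_gt0//; lra.
exists eta => // sigma s0; have se0 : 0 <= sigma + eta by lra.
pose T s : S -> S := twist (fun n => npow_neg n (s%:C%C : R[i])).
have -> : shift (sigma + eta) - shift sigma =
    T (sigma + eta) (a - p) - T sigma (a - p) + (T (sigma + eta) p - T sigma p).
  by rewrite /shift /T !twistB; ring.
have -> : d = (d / 4 + d / 4) + d / 2 by field.
apply: wbdD => //.
  by apply: wbdB => //; apply: wbd_twist_npow.
have hf i : (L <= i)%N -> (T (sigma + eta) p - T sigma p) i = 0.
  by move=> Li; rewrite dseriesBE /T /twist /p /trunc ltnNge Li /= !scaler0 subrr.
apply: wbd_le (wbd_finite hw hf).
apply: (@le_trans _ _ (eta * D)); last first.
  by rewrite /eta mulrAC -mulrA ger_pMr ?divr_gt0// ler_pdivrMr; lra.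
rewrite /D mulr_sumr; apply: ler_sum => i _; rewrite !mulrA ler_wpM2r//; first exact: weight_ge0.
rewrite dseriesBE /T /twist !npow_neg_realE /p /trunc ltn_ord.
rewrite -scalerBl -rmorphB nrm_realZ ler_wpM2r ?nrm_ge0// expR_dist//; first exact: ltW.
by rewrite ln_ge0// ler1n.
Qed.

(** Index 0, the integer 1, is untouched, while every other coefficient is damped by at least
    [expR (- (sigma * ln 2))]. The threshold [K / d / ln 2] comes from [1 + x <= expR x]. *)
Lemma shift_const d : 0 < d -> exists2 sigma0, 0 <= sigma0 &
  forall sigma, sigma0 <= sigma -> wbd w (constd (a 0%N) - shift sigma) d.
Proof.
move=> d0; have K0 := wbd_ge0 ha.
have l2 : 0 < ln (2 : R) by rewrite ln_gt0//; lra.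
have s00 : 0 <= K / d / ln 2 by rewrite !divr_ge0// ltW.
exists (K / d / ln 2) => // sigma hs; have s0 : 0 <= sigma by exact: le_trans hs.
have hK : expR (- (sigma * ln 2)) * K <= d.
  have h1 : K / d <= sigma * ln 2 by rewrite -ler_pdivrMr.
  have h2 : K <= expR (sigma * ln 2) * d.
    rewrite -ler_pdivrMr//; apply: (le_trans h1).
    by apply: le_trans (expR_ge1Dx _); lra.
  by rewrite expRN mulrC ler_pdivrMr ?expR_gt0// mulrC.
apply: wbd_le hK _; apply: (wbd_scale hw (a := a) (expR_ge0 _)) => // i.
rewrite dseriesBE shiftE /constd; case: i => [|i] /=.
  by rewrite ln1 mulr0 expR0 scale1r subrr nrm0 mulr_ge0 ?expR_ge0 ?nrm_ge0.
rewrite sub0r nrmN nrm_realZ ler_wpM2r ?nrm_ge0// ger0_norm ?expR_ge0//.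
rewrite ler_expR mulNr lerN2 ler_wpM2l// ler_ln ?posrE ?ltr0n//.
by rewrite ler_nat.
Qed.

Variable M : R.
Hypothesis M0 : 0 < M.
Hypothesis hM : forall s, halfplane s -> exists2 y, ev a s * y = 1 & nrm y <= M.
Hypothesis hM0 : exists2 y, a 0%N * y = 1 & nrm y <= M.

Lemma inverse_of_bounded : exists b : S, (exists K', wbd w b K') /\ a * b = 1.
Proof.
pose Inv sigma := exists b : S, (exists K', wbd w b K') /\ shift sigma * b = 1.
pose d := (2 * M)^-1.
have d0 : 0 < d by rewrite invr_gt0 mulr_gt0.
have dM : d * M < 1 by rewrite /d invfM -mulrA mulVf ?gt_eqF// mulr1; lra.
have step sigma sigma' : 0 <= sigma -> wbd w (shift sigma - shift sigma') d -> Inv sigma -> Inv sigma'.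
  move=> s0 hd [b [[K' hb] eb]].
  apply: (inverse_step hw aw (wbd_shift s0) hb eb (ltW M0) _ hd dM) => s hs.
  have hs' : halfplane (s + sigma%:C%C).
    move: hs; rewrite /halfplane; case: s => x y /= x0; exact: addr_ge0.
  have [y ey yM] := hM hs'.
  (* The inverse series takes the pointwise inverses as values, so it inherits the bound [M]
     whatever its weighted norm. *)
  have -> // : ev b s = y.
  apply: inv_unique ey; rewrite -ev_shift -(evM hw hs (wbd_shift s0) hb) eb.
  exact: ev1.
have [sigma0 s00 hs0] := shift_const d0.
have [eta eta0 heta] := shift_uniform d0.
pose n := Num.bound (sigma0 / eta).
have hn : sigma0 <= n%:R * eta.
  by rewrite -ler_pdivrMr// ltW// archi_boundP// divr_ge0// ltW.
have start : Inv (n%:R * eta).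
  have [y ey yM] := hM0.
  have hy s : halfplane s -> nrm (ev (constd y) s) <= M by rewrite ev_const.
  apply: (inverse_step hw aw (wbd_const hw (a 0%N)) (wbd_const hw y) _ (ltW M0) hy (hs0 _ hn) dM).
  by rewrite constdM; apply/funext => i; rewrite /constd dseries1E; case: ifP => //; rewrite mulr0.
have : Inv 0; last by rewrite /Inv shift0.
(* Descent from [n%:R * eta] to 0 in steps of length [eta]. *)
rewrite -(mul0r eta) -[0]/(0%:R); elim: n start {hn} => // k IH h; apply: IH.
apply: step h; first by rewrite mulr_ge0// ltW.
rewrite -natr1 mulrDl mul1r; apply: heta.
by rewrite mulr_ge0// ltW.
Qed.

End Path.

(** * Uniform bound on the pointwise inverses *)

(** Compactness of a bounded interval: the limit is the supremum of the levels that [h] reaches on a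
    set of [U], and the ultrafilter decides every level. *)
Lemma ultra_bounded_cvg (R : realType) (T : Type) (U : set_system T) (h : T -> R) (c : R) :
  UltraFilter U -> U [set s | `|h s| <= c] ->
  exists l, forall eps, 0 < eps -> U [set s | `|h s - l| <= eps].
Proof.
move=> UU hU; have FU : ProperFilter U := @ultra_proper _ _ UU.
pose E := [set x : R | U [set s | x <= h s]].
have hs : has_sup E.
  split.
    exists (- c); apply: filterS hU => s /=; by rewrite ler_norml => /andP[].
  exists c => x hx; have [s [/= h1]] := filter_ex (filterI hx hU).
  by rewrite ler_norml => /andP[_ h2]; exact: le_trans h1 h2.
exists (sup E) => eps e0.
have [x Ex hx] := sup_adherent e0 hs.
have h2 : ~ E (sup E + eps).
  move=> hE; have : sup E + eps <= sup E by apply: ub_le_sup hE; case: hs.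
  lra.
have [//|h3] := in_ultra_setVsetC [set s | sup E + eps <= h s] UU.
apply: filterS (filterI Ex h3) => s [/= h4 /negP]; rewrite -ltNge => h5.
by rewrite ler_norml; apply/andP; split; lra.
Qed.

Lemma Re_norm_le (R : realType) (z : R[i]) :
  complex.Re `|z| <= `|complex.Re z| + `|complex.Im z|.
Proof.
rewrite normc_def /=; case: z => x y /=.
have h : x ^+ 2 + y ^+ 2 <= (`|x| + `|y|) ^+ 2.
  by rewrite sqrrD !real_normK ?num_real// addrAC lerDl mulrn_wge0// mulr_ge0.
by apply: le_trans (ler_wsqrtr h) _; rewrite sqrtr_sqr ger0_norm// addr_ge0.
Qed.

Section BoundedInverse.
Variables (R : realType) (A : completeNormedModType R[i]) (B : comBanachAlg A).
Local Notation V := (alg_of B).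
Local Notation S := (dseries V).

(** The Cauchy property of [g] along [U]; using differences, it adds up over finite sums without
    naming limits in [A]. *)
Definition oscillates_little (U : set_system R[i]) (g : R[i] -> V) : Prop :=
  forall eps, 0 < eps -> exists2 P, U P & forall s s', P s -> P s' -> nrm (g s - g s') <= eps.

(** Only a bounded scalar varies, so compactness in [R] suffices although [A] may be
    infinite-dimensional; finite sums and a uniform tail estimate extend this to [ev a]. *)
Lemma osc_npow (U : set_system R[i]) (n : nat) (x : V) : UltraFilter U -> U (@halfplane R) ->
  oscillates_little U (fun s => npow_neg n.+1 s *: x).
Proof.
move=> UU UH eps e0; have FU : ProperFilter U := @ultra_proper _ _ UU.
have hb (h : R[i] -> R) : (forall z, `|h z| <= complex.Re `|z|) ->
    U [set s | `|h (npow_neg n.+1 s)| <= 1].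
  move=> hh; apply: filterS UH => s hs /=; apply: le_trans (hh _) _.
  exact: Re_norm_npow_neg_le1.
have hRe z : `|@complex.Re R z| <= complex.Re `|z|.
  rewrite normc_def /=; case: z => u v /=.
  by rewrite -sqrtr_sqr ler_wsqrtr// lerDl sqr_ge0.
have hIm z : `|@complex.Im R z| <= complex.Re `|z|.
  rewrite normc_def /=; case: z => u v /=.
  by rewrite -sqrtr_sqr ler_wsqrtr// lerDr sqr_ge0.
have [l1 h1] := ultra_bounded_cvg UU (hb _ hRe).
have [l2 h2] := ultra_bounded_cvg UU (hb _ hIm).
pose d := eps / (4 * (nrm x + 1)).
have x0 := nrm_ge0 x.
have d0 : 0 < d by rewrite divr_gt0// mulr_gt0//; lra.
exists ([set s | `|complex.Re (npow_neg n.+1 s) - l1| <= d] `&`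
        [set s | `|complex.Im (npow_neg n.+1 s) - l2| <= d]).
  by apply: filterI; [exact: h1 | exact: h2].
move=> s s' [/= a1 a2] [/= b1 b2]; rewrite -scalerBl nrmZ.
have : complex.Re `|npow_neg n.+1 s - npow_neg n.+1 s'| <= 4 * d.
  apply: (le_trans (Re_norm_le _)).
  rewrite (_ : complex.Re _ = complex.Re (npow_neg n.+1 s) - complex.Re (npow_neg n.+1 s')); last first.
    by case: (npow_neg n.+1 s) (npow_neg n.+1 s') => ? ? [].
  rewrite (_ : complex.Im _ = complex.Im (npow_neg n.+1 s) - complex.Im (npow_neg n.+1 s')); last first.
    by case: (npow_neg n.+1 s) (npow_neg n.+1 s') => ? ? [].
  have t1 := ler_distD l1 (complex.Re (npow_neg n.+1 s)) (complex.Re (npow_neg n.+1 s')).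
  have t2 := ler_distD l2 (complex.Im (npow_neg n.+1 s)) (complex.Im (npow_neg n.+1 s')).
  rewrite (distrC l1) in t1; rewrite (distrC l2) in t2; lra.
move=> h; apply: (@le_trans _ _ (4 * d * nrm x)); first by rewrite ler_wpM2r.
rewrite (_ : 4 * d * nrm x = eps * (nrm x / (nrm x + 1))); last first.
  by rewrite /d; field; lra.
by rewrite ger_pMr// ler_pdivrMr; lra.
Qed.

Lemma osc_sum (U : set_system R[i]) (L : nat) (g : nat -> R[i] -> V) : ProperFilter U ->
  (forall i, oscillates_little U (g i)) ->
  oscillates_little U (fun s => \sum_(i < L) g i s).
Proof.
move=> FU hg; elim: L => [|L IH] eps e0.
  exists setT; first exact: filterT.
  by move=> s s' _ _; rewrite !big_ord0 subrr nrm0 ltW.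
have e2 : 0 < eps / 2 by rewrite divr_gt0.
have [P UP hP] := IH _ e2; have [Q UQ hQ] := hg L _ e2.
exists (P `&` Q); first exact: filterI.
move=> s s' [Ps Qs] [Ps' Qs']; rewrite !big_ord_recr /= opprD addrACA.
apply: (le_trans (nrmD _ _)); have := hP _ _ Ps Ps'; have := hQ _ _ Qs Qs'; lra.
Qed.

Variable w : nat -> R.
Hypothesis hw : weight w.
Variables (a : S) (K : R).
Hypothesis ha : wbd w a K.

Lemma osc_ev (U : set_system R[i]) : UltraFilter U -> U (@halfplane R) ->
  oscillates_little U (ev a).
Proof.
move=> UU UH eps e0; have FU : ProperFilter U := @ultra_proper _ _ UU.
have e4 : 0 < eps / 4 by rewrite divr_gt0.
have e2 : 0 < eps / 2 by rewrite divr_gt0.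
have [L hL] := wbd_tail hw ha e4.
have [P UP hP] := osc_sum L FU (fun i => osc_npow i (a i) UU UH) e2.
exists (P `&` @halfplane R); first exact: filterI.
move=> s s' [Ps hs] [Ps' hs'].
have dec t : halfplane t -> nrm (ev a t - \sum_(i < L) npow_neg i.+1 t *: a i) <= eps / 4.
  move=> ht; rewrite -(ev_trunc hw ht L ha) -(evB hw ht ha (wbd_trunc hw L ha)).
  exact (nrm_ev hw ht hL).
have := hP _ _ Ps Ps'; have := dec _ hs; have := dec _ hs'; rewrite [X in X <= _ -> _]nrmBC => d1 d2 d3.
apply: (le_trans (nrm_dist (\sum_(i < L) npow_neg i.+1 s *: a i) _ _)).
have := nrm_dist (\sum_(i < L) npow_neg i.+1 s' *: a i) (\sum_(i < L) npow_neg i.+1 s *: a i) (ev a s').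
lra.
Qed.

Hypothesis hinv : forall x : V,
  (forall eps, 0 < eps -> exists2 s, halfplane s & nrm (x - ev a s) <= eps) ->
  exists y, x * y = 1.

(* The range of [ev a] is totally bounded: along an ultrafilter on which the inverses blow up,
   [ev a] converges to a point of the closure, whose invertibility is contradicted. *)
Lemma bounded_inverse : exists2 M, 0 < M &
  forall s, halfplane s -> exists2 y, ev a s * y = 1 & nrm y <= M.
Proof.
apply: contrapT => hn.
pose Bad M := [set s | halfplane s /\ ~ exists2 y, ev a s * y = 1 & nrm y <= M].
have Bad_le M M' : M <= M' -> Bad M' `<=` Bad M.
  by move=> MM' s [hs h]; split => // -[y ey yM]; apply: h; exists y => //; exact: le_trans MM'.
(* The negated goal concerns positive bounds only, hence [Num.max M 1]. *)
have Bad0 M : Bad M !=set0.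
  apply: contrapT => h; apply: hn; exists (Num.max M 1); first by rewrite lt_max ltr01 orbT.
  move=> s hs; apply: contrapT => h'; apply: h; exists s; apply: Bad_le (_ : Bad (Num.max M 1) s).
    by rewrite le_max lexx.
  by split.
have FF : ProperFilter (filter_from [set: R] Bad).
  apply: filter_from_proper => //; apply: filter_from_filter; first by exists 0.
  move=> M M' _ _; exists (Num.max M M') => // s hs.
  by split; apply: Bad_le hs; rewrite le_max lexx ?orbT.
have [U [UU FU]] := ultraFilterLemma FF.
have PU : ProperFilter U := @ultra_proper _ _ UU.
have UBad M : U (Bad M) by apply: FU; exists M.
have UH : U (@halfplane R) by apply: filterS (UBad 0) => s [].
have hosc := osc_ev UU UH.
have cF : cvg ((ev a : R[i] -> A) @ U).
  apply: cauchy_cvg; apply: cauchy_exP => eps e0.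
  have e0' : 0 < complex.Re eps by move: e0; rewrite ltcE => /andP[].
  have [P UP hP] := hosc _ (divr_gt0 e0' (ltr0n R 2)).
  have [s' Ps'] := filter_ex UP.
  exists (ev a s'); rewrite /= /fmap /=.
  apply: (@filterS _ U _ P _ _ UP) => s Ps /=; rewrite -ball_normE /=.
  rewrite (_ : eps = (complex.Re eps)%:C%C); last by rewrite RRe_real// gtr0_real.
  rewrite (norm_nrm (ev a s' - ev a s)) ltcR.
  by apply: (le_lt_trans (hP _ _ Ps' Ps)); lra.
set x : V := lim ((ev a : R[i] -> A) @ U).
have hx eps : 0 < eps -> U [set s | nrm (x - ev a s) <= eps].
  move=> e0; have e0' : 0 < eps%:C%C by rewrite ltcR.
  have /cvgrPdist_le/(_ _ e0') := cF; apply: filterS => s /=.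
  by rewrite (norm_nrm (x - ev a s)) lecR.
have [y xy] : exists y, x * y = 1.
  apply: hinv => eps e0; have [s [h1 h2]] := filter_ex (filterI (hx _ e0) UH).
  by exists s.
have y0 : 0 < nrm y.
  rewrite lt_neqAle nrm_ge0 andbT eq_sym; apply/eqP => /nrm_eq0 y0.
  by move/eqP: xy; rewrite y0 mulr0 eq_sym oner_eq0.
have e0 : 0 < 2^-1 / nrm y by rewrite divr_gt0// invr_gt0.
(* This [s] has [ev a s] close to [x], which forces an inverse of norm at most [2 * nrm y], yet it
   was taken from [Bad (2 * nrm y)]. *)
have [s [/= h1 [hs]]] := filter_ex (filterI (hx _ e0) (UBad (2 * nrm y))).
apply; apply: perturb_inverse xy _.
by apply: le_trans (ler_wpM2r (ltW y0) h1) _; rewrite divfK ?gt_eqF.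
Qed.

End BoundedInverse.

(** * Translation between coefficient series and functions on the half-plane *)

Section Interface.
Variables (R : realType) (A : completeNormedModType R[i]) (B : comBanachAlg A).
Variable w : nat -> R.
Hypothesis hw : weight w.

Lemma wsummable_wbd (c : nat -> A) :
  wsummable w c <-> exists K, wbd w ((fun i => c i.+1) : dseries (alg_of B)) K.
Proof.
have t0 n : (1 <= n)%N -> true -> (0 <= (complex.Re `|c n| * w n)%:E)%E.
  by case: n => // n _ _; rewrite lee_fin mulr_ge0 ?(nrm_ge0 (c n.+1 : alg_of B))// weight_ge0.
have pE N : (\sum_(1 <= n < N.+1) (complex.Re `|c n| * w n)%:E =
    (\sum_(i < N) nrm (c i.+1 : alg_of B) * w i.+1)%:E)%E.
  by rewrite big_add1 big_mkord sumEFin.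
split => [|[K hK]].
  rewrite /wsummable; set T := (X in (X < _)%E) => hT.
  have T0 : (0 <= T)%E by apply: nneseries_ge0 => n n1 _; exact: t0.
  exists (fine T) => N; rewrite -lee_fin -pE fineK ?ge0_fin_numE//.
  exact: nneseries_lim_ge.
rewrite /wsummable; apply: le_lt_trans (ltry K); apply: lime_le.
  by apply: is_cvg_nneseries => n n1 _; exact: t0.
exists 1%N => // -[//|N] _ /=; rewrite pE lee_fin; exact: hK.
Qed.

Lemma closureP_nrm (X : set A) (x : A) : closure X x <->
  forall eps, 0 < eps -> exists2 y, X y & nrm ((x : alg_of B) - y) <= eps.
Proof.
split=> [h eps e0|h P /nbhs_ballP[eps /= e0 hP]].
  have e0' : 0 < eps%:C%C by rewrite ltcR.
  have [y [Xy]] := h _ (nbhsx_ballx x _ e0'); rewrite -ball_normE /=.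
  by rewrite (norm_nrm (x - y : alg_of B)) ltcR => /ltW; exists y.
have e0' : 0 < complex.Re eps by move: e0; rewrite ltcE => /andP[].
have [y Xy hy] := h _ (divr_gt0 e0' (ltr0n R 2)); exists y; split => //.
apply: hP; rewrite -ball_normE /=.
rewrite (_ : eps = (complex.Re eps)%:C%C); last by rewrite RRe_real// gtr0_real.
rewrite (norm_nrm (x - y : alg_of B)) ltcR; apply: le_lt_trans hy _; lra.
Qed.

Lemma inD_ev (f : R[i] -> A) : inD w f <-> exists (a : dseries (alg_of B)) K,
  wbd w a K /\ forall s, halfplane s -> f s = ev a s.
Proof.
split=> [[c [/wsummable_wbd[K hK] hf]]|[a [K [hK hf]]]].
  by exists (fun i => c i.+1), K; split => // s hs; rewrite hf// (dirichlet_ev hw hs hK).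
(* The value at [n = 0] is arbitrary, since all sums start at 1. *)
exists (fun n => a n.-1); split; first by apply/wsummable_wbd; exists K.
by move=> s hs; rewrite hf// (@dirichlet_ev _ _ B _ hw _ hs (fun n => a n.-1) K hK).
Qed.

End Interface.

Theorem mainTheorem3 (R : realType) (w : nat -> R)
    (A : completeNormedModType R[i]) (B : comBanachAlg A) (f : R[i] -> A) :
  weight w -> admissible w -> inD w f ->
  ((exists g : R[i] -> A, inD w g /\
       forall s, halfplane s -> bmul B (f s) (g s) = bone B)
   <-> closure (f @` @halfplane R) `<=` invertibles B).
Proof.
move=> hw aw /(inD_ev B hw)[a [K [ha hf]]]; split.
  move=> [g [/(inD_ev B hw)[b [K' [hb hg]]] fg]] x /(closureP_nrm B) hx.
  have K'0 := wbd_ge0 hb.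
  (* The inverses [g s] are bounded by [K' + 1], so [perturb_inverse] reaches every point this close
     to a value of [f]. *)
  have d0 : 0 < (2 * (K' + 1))^-1 by rewrite invr_gt0 mulr_gt0//; lra.
  have [_ [s hs <-] xs] := hx _ d0.
  have gK : nrm (g s : alg_of B) <= K' + 1.
    by rewrite hg//; apply: le_trans (nrm_ev hw hs hb) _; rewrite lerDl.
  have [|y xy _] := @perturb_inverse _ _ B (f s) x (g s) (fg s hs); last by exists y.
  apply: le_trans (ler_pM _ _ _ gK) _; [exact: nrm_ge0|exact: nrm_ge0|by rewrite nrmBC; exact: xs|].
  by rewrite invfM -mulrA mulVf ?mulr1//; lra.
move=> hcl.
have hinv (x : alg_of B) :
    (forall eps, 0 < eps -> exists2 s, halfplane s & nrm (x - ev a s) <= eps) -> exists y, x * y = 1.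
  move=> hx; apply: hcl; apply/(closureP_nrm B) => eps /hx[s hs xs].
  by exists (f s); [exists s | rewrite hf].
have [M M0 hM] := bounded_inverse hw ha hinv.
(* The coefficient [a 0] is the limit of [f] along real [sigma] tending to [+oo], so it lies in the
   closure. *)
have [y0 ay0] : exists y, a 0%N * y = 1.
  apply: hinv => eps e0; have [sigma s0 h] := shift_const hw ha e0.
  exists sigma%:C%C; first exact: halfplane_real.
  have h0 : halfplane (0 : R[i]) by exact: (@halfplane_real R 0).
  rewrite -[sigma%:C%C]add0r -(ev_shift a sigma 0) -(ev_const 0 (a 0%N)).
  rewrite -(evB hw h0 (wbd_const hw (a 0%N)) (wbd_shift hw ha s0)).
  exact (nrm_ev hw h0 (h _ (lexx _))).
have [b [[K' hb] ab]] : exists b, (exists K', wbd w b K') /\ a * b = 1.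
  apply: (@inverse_of_bounded _ _ B w hw aw a K ha (M + nrm y0)).
  - by rewrite ltr_pwDl// nrm_ge0.
  - by move=> s /hM[y ey yM]; exists y => //; rewrite (le_trans yM)// lerDl nrm_ge0.
  - by exists y0 => //; rewrite lerDr ltW.
exists (ev b); split; first by apply/(inD_ev B hw); exists b, K'.
move=> s hs; rewrite hf//; have := evM hw hs ha hb; rewrite ab ev1.
exact: esym.
Qed.
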